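(* $\mathbf{IKP}$ and $\mathbf{IKP}+\Sigma\text{-Reflection}$ prove the same $\Sigma$-sentences. In particular, if $\mathbf{IKP}\vdash A$ with $A$ a $\Sigma$-sentence, then $\mathbf{IKP}\vdash\exists x\,A^{x}$.
   Context: $\mathbf{IKP}$ is Kripke–Platek set theory with intuitionistic logic: axioms Extensionality, Pair, Union, Infinity, $\Delta_0$-Separation, $\Delta_0$-Collection, and Set Induction for all formulas ($\Delta_0$ = no unbounded quantifiers). $\Sigma$-formulas: every $\Delta_0$-formula is $\Sigma$ and $\Pi$; $\Sigma$ (resp. $\Pi$) formulas are closed under $\wedge,\vee$, bounded quantifiers $\forall x\in s,\exists x\in s$; $\exists xA$ is $\Sigma$ for $\Sigma$ $A$ and $\forall xA$ is $\Pi$ for $\Pi$ $A$; if $A$ is $\Pi$ and $B$ is $\Sigma$ then $A\to B,\neg A$ are $\Sigma$ and $B\to A,\neg B$ are $\Pi$. For a formula $A$ and variable $z$, $A^{z}$ results from $A$ by replacing each unbounded quantifier $\forall x,\exists y$ by $\forall x\in z,\exists y\in z$. $\Sigma$-Reflection is the schema $A\to\exists z\,A^{z}$ for all $\Sigma$-formulas $A$. *)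

(* Defs.v *)
From Stdlib Require Import List Arith.
Import ListNotations.

(* Formulas with de Bruijn variables (terms are variables only).
   Bounded quantifiers are primitive syntax: [BAll s A] is ∀x∈s A and
   [BEx s A] is ∃x∈s A, where the bound x is index 0 in A and the bounding
   variable s is interpreted in the context of the quantifier itself. *)
Inductive form : Type :=
| Mem  : nat -> nat -> form
| Eq   : nat -> nat -> form
| Bot  : form
| And  : form -> form -> form
| Or   : form -> form -> form
| Imp  : form -> form -> form
| All  : form -> form
| Ex   : form -> form
| BAll : nat -> form -> form
| BEx  : nat -> form -> form.

Definition Neg (A : form) : form := Imp A Bot.
Definition Iff (A B : form) : form := And (Imp A B) (Imp B A).

Definition up (s : nat -> nat) (n : nat) : nat :=
  match n with 0 => 0 | S n => S (s n) end.

Fixpoint rename (s : nat -> nat) (A : form) : form :=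
  match A with
  | Mem i j => Mem (s i) (s j)
  | Eq i j => Eq (s i) (s j)
  | Bot => Bot
  | And A B => And (rename s A) (rename s B)
  | Or A B => Or (rename s A) (rename s B)
  | Imp A B => Imp (rename s A) (rename s B)
  | All A => All (rename (up s) A)
  | Ex A => Ex (rename (up s) A)
  | BAll t A => BAll (s t) (rename (up s) A)
  | BEx t A => BEx (s t) (rename (up s) A)
  end.

Definition shift_from (k n : nat) (i : nat) : nat := if i <? k then i else i + n.
Definition lift (A : form) : form := rename S A.
Definition inst (x : nat) (i : nat) : nat := match i with 0 => x | S i => i end.
Definition subst0 (A : form) (x : nat) : form := rename (inst x) A.

Fixpoint unfold (A : form) : form :=
  match A with
  | Mem i j => Mem i j
  | Eq i j => Eq i j
  | Bot => Bot
  | And A B => And (unfold A) (unfold B)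
  | Or A B => Or (unfold A) (unfold B)
  | Imp A B => Imp (unfold A) (unfold B)
  | All A => All (unfold A)
  | Ex A => Ex (unfold A)
  | BAll s A => All (Imp (Mem 0 (S s)) (unfold A))
  | BEx s A => Ex (And (Mem 0 (S s)) (unfold A))
  end.

Fixpoint fv_below (n : nat) (A : form) : Prop :=
  match A with
  | Mem i j | Eq i j => i < n /\ j < n
  | Bot => True
  | And A B | Or A B | Imp A B => fv_below n A /\ fv_below n B
  | All A | Ex A => fv_below (S n) A
  | BAll s A | BEx s A => s < n /\ fv_below (S n) A
  end.
Definition sentence (A : form) : Prop := fv_below 0 A.

Fixpoint Delta0 (A : form) : Prop :=
  match A with
  | Mem _ _ | Eq _ _ | Bot => True
  | And A B | Or A B | Imp A B => Delta0 A /\ Delta0 B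
  | All _ | Ex _ => False
  | BAll _ A | BEx _ A => Delta0 A
  end.

Inductive Sigma : form -> Prop :=
| Sig_D0 A : Delta0 A -> Sigma A
| Sig_And A B : Sigma A -> Sigma B -> Sigma (And A B)
| Sig_Or A B : Sigma A -> Sigma B -> Sigma (Or A B)
| Sig_BAll s A : Sigma A -> Sigma (BAll s A)
| Sig_BEx s A : Sigma A -> Sigma (BEx s A)
| Sig_Ex A : Sigma A -> Sigma (Ex A)
| Sig_Imp A B : Pi A -> Sigma B -> Sigma (Imp A B)
| Sig_Neg A : Pi A -> Sigma (Neg A)
with Pi : form -> Prop :=
| Pi_D0 A : Delta0 A -> Pi A
| Pi_And A B : Pi A -> Pi B -> Pi (And A B)
| Pi_Or A B : Pi A -> Pi B -> Pi (Or A B)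
| Pi_BAll s A : Pi A -> Pi (BAll s A)
| Pi_BEx s A : Pi A -> Pi (BEx s A)
| Pi_All A : Pi A -> Pi (All A)
| Pi_Imp A B : Sigma A -> Pi B -> Pi (Imp A B)
| Pi_Neg A : Sigma A -> Pi (Neg A).

Fixpoint rel (A : form) (z : nat) : form :=
  match A with
  | Mem i j => Mem i j
  | Eq i j => Eq i j
  | Bot => Bot
  | And A B => And (rel A z) (rel B z)
  | Or A B => Or (rel A z) (rel B z)
  | Imp A B => Imp (rel A z) (rel B z)
  | All A => BAll z (rel A (S z))
  | Ex A => BEx z (rel A (S z))
  | BAll s A => BAll s (rel A (S z))
  | BEx s A => BEx s (rel A (S z))
  end.

Inductive ND (T : form -> Prop) : list form -> form -> Prop :=
| nd_hyp G A : In A G -> ND T G A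
| nd_ax G A : T A -> ND T G A
| nd_botE G A : ND T G Bot -> ND T G A
| nd_andI G A B : ND T G A -> ND T G B -> ND T G (And A B)
| nd_andE1 G A B : ND T G (And A B) -> ND T G A
| nd_andE2 G A B : ND T G (And A B) -> ND T G B
| nd_orI1 G A B : ND T G A -> ND T G (Or A B)
| nd_orI2 G A B : ND T G B -> ND T G (Or A B)
| nd_orE G A B C : ND T G (Or A B) -> ND T (A :: G) C -> ND T (B :: G) C -> ND T G C
| nd_impI G A B : ND T (A :: G) B -> ND T G (Imp A B)
| nd_impE G A B : ND T G (Imp A B) -> ND T G A -> ND T G B
| nd_allI G A : ND T (map lift G) A -> ND T G (All A)
| nd_allE G A x : ND T G (All A) -> ND T G (subst0 A x)
| nd_exI G A x : ND T G (subst0 A x) -> ND T G (Ex A)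
| nd_exE G A B : ND T G (Ex A) -> ND T (A :: map lift G) (lift B) -> ND T G B
| nd_eqrefl G x : ND T G (Eq x x)
| nd_eqsubst G A x y : ND T G (Eq x y) -> ND T G (subst0 A x) -> ND T G (subst0 A y).

(* T ⊢ A  (bounded quantifiers read as abbreviations) *)
Definition Prov (T : form -> Prop) (A : form) : Prop :=
  ND (fun B => exists C, T C /\ B = unfold C) [] (unfold A).

(* Axioms of IKP (schemata with arbitrary parameters, as free variables) *)
Inductive IKP : form -> Prop :=
| ikp_ext : IKP (All (All (Imp (All (Iff (Mem 0 2) (Mem 0 1))) (Eq 1 0))))
| ikp_pair : IKP (All (All (Ex (And (Mem 2 0) (Mem 1 0)))))
| ikp_union : IKP (All (Ex (BAll 1 (BAll 0 (Mem 0 2)))))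
| ikp_inf : IKP (Ex (And (Ex (Mem 0 1)) (BAll 0 (BEx 1 (Mem 1 0)))))
| ikp_sep A : Delta0 A ->
    (* A(x, params): x = index 0 *)
    IKP (All (Ex (All (Iff (Mem 0 1)
           (And (Mem 0 2) (rename (shift_from 1 2) A))))))
| ikp_coll A : Delta0 A ->
    (* A(x, y, params): y = index 0, x = index 1 *)
    IKP (All (Imp (BAll 0 (Ex (rename (shift_from 2 1) A)))
                  (Ex (BAll 1 (BEx 1 (rename (shift_from 2 2) A))))))
| ikp_ind A :
    (* A(x, params): x = index 0 *)
    IKP (Imp (All (Imp (BAll 0 (rename (shift_from 1 1) A)) A)) (All A)).

Definition SigmaRefl (B : form) : Prop :=
  exists A, Sigma A /\ B = Imp A (Ex (rel (lift A) 0)).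

Definition IKP_SigmaRefl (B : form) : Prop := IKP B \/ SigmaRefl B.

(* Main.v *)
(* Reflection is made true by forcing, the forcing relation being definable in IKP.
   A condition p is a set of codes of instances of finitely many Pi-formulas, and
   T(p,z) states that all of them hold relativised to z. An answer e codes an
   instance of a Sigma-formula; p forces it when ex z (T(p,z) -> E(e,z)), where E(e,z)
   is the instance relativised to z. Atoms are forced in the same way, implication and
   the universal quantifier are treated as in Kripke models, and existence (likewise
   disjunction) by continuations: p forces ex x A when every q below p forces every
   answer e such that all r below q which force some A(x) also force e.

   T(p,z) and E(e,z) are Delta0, so Delta0-Collection, applied to a set coding the
   truth value of T(p,z), moves a quantifier ex z' out of the scope of the hypothesis
   T(p,z). Hence a Delta0-formula A is forced by p iff ex z (T(p,z) -> A); a forced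
   Sigma-formula satisfies ex z (T(p,z) -> A^z); and a Pi-formula A is forced by every
   condition containing it. The last two facts yield Sigma-Reflection, and Set Induction
   is inherited because forcing is definable. So whatever Sigma-sentence A is
   provable with Sigma-Reflection is forced by the empty condition, that is, ex z A^z.

   Provability in IKP is handled through the Heyting-valued model whose individuals
   are the variables and whose worlds are the contexts: there truth is derivability. *)

From Stdlib Require Import List Arith Lia Classical FunctionalExtensionality.
Require Import Defs.
Import ListNotations.

(** * Environments, renaming and bounds on free variables *)

Definition scons {X : Type} (x : X) (r : nat -> X) (n : nat) : X :=
  match n with 0 => x | S n => r n end.
Infix ".:" := scons (at level 55, right associativity).

Lemma scons_up {X} (x : X) r s : (fun n => (x .: r) (up s n)) = x .: (fun n => r (s n)).
Proof. extensionality n; now destruct n. Qed.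

Lemma inst_scons {X} (r : nat -> X) x : (fun n => r (inst x n)) = r x .: r.
Proof. extensionality n; now destruct n. Qed.

Lemma up_comp s t : (fun n => up s (up t n)) = up (fun n => s (t n)).
Proof. extensionality n; now destruct n. Qed.

Lemma rename_rename A : forall s t, rename s (rename t A) = rename (fun n => s (t n)) A.
Proof.
  induction A; intros s t; cbn; rewrite ?IHA, ?IHA1, ?IHA2, ?up_comp; reflexivity.
Qed.

Lemma up_id : up (fun n => n) = fun n => n.
Proof. extensionality n; now destruct n. Qed.

Lemma rename_id A : rename (fun n => n) A = A.
Proof. induction A; cbn; rewrite ?up_id; congruence. Qed.

Lemma unfold_rename A : forall s, unfold (rename s A) = rename s (unfold A).
Proof. induction A; intros s; cbn; rewrite ?IHA, ?IHA1, ?IHA2; reflexivity. Qed.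

Lemma Delta0_rename A : forall s, Delta0 A -> Delta0 (rename s A).
Proof. induction A; cbn; intuition. Qed.

Lemma fv_below_mono A : forall m n, m <= n -> fv_below m A -> fv_below n A.
Proof.
  induction A; cbn; intros m k Hk H; repeat split; try lia;
    try (eapply IHA1; [|apply H]; lia); try (eapply IHA2; [|apply H]; lia);
    (eapply IHA; [|apply H]; lia).
Qed.

Lemma fv_below_exists A : exists n, fv_below n A.
Proof.
  induction A as [i j|i j| |A [n1 H1] B [n2 H2]|A [n1 H1] B [n2 H2]|A [n1 H1] B [n2 H2]
    |A [n H]|A [n H]|s A [n H]|s A [n H]]; cbn.
  1,2: exists (S (i + j)); lia.
  1: now exists 0.
  1-3: exists (n1 + n2); split; [apply (fv_below_mono A n1)|apply (fv_below_mono B n2)]; auto; lia.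
  1,2: exists n; apply (fv_below_mono A n); auto.
  1,2: exists (S (s + n)); split; [lia | apply (fv_below_mono A n); auto; lia].
Qed.

Lemma rename_ext A : forall n s t, fv_below n A -> (forall i, i < n -> s i = t i) ->
  rename s A = rename t A.
Proof.
  assert (Hup : forall n s t, (forall i, i < n -> s i = t i) ->
    forall i, i < S n -> up s i = up t i).
  { intros n s t H [|i] Hi; cbn; auto. rewrite H; auto; lia. }
  induction A; cbn; intros k s t Hfv H; f_equal; intuition eauto.
Qed.

Scheme Sigma_Pi_ind := Minimality for Sigma Sort Prop
  with Pi_Sigma_ind := Minimality for Pi Sort Prop.
Combined Scheme Sigma_Pi_mutind from Sigma_Pi_ind, Pi_Sigma_ind.

Lemma Delta0_rel A : forall z, Delta0 (rel A z).
Proof. induction A; cbn; auto. Qed.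

(** * Truth values over a preordered frame *)

Section Frame.
Context {W I D : Type} {le : W -> W -> Prop} {bp : I -> W -> Prop}.
Context (le_refl : forall w, le w w)
  (le_trans : forall w1 w2 w3, le w1 w2 -> le w2 w3 -> le w1 w3)
  (bp_mono : forall i w w', le w w' -> bp i w -> bp i w').

(* Truth values: upsets of worlds that are closed for the nucleus generated by the
   basic propositions [bp i]; disjunction and existence are closed unions. *)
Record Om := mkOm {
  holds : W -> Prop;
  holds_mono : forall w w', le w w' -> holds w -> holds w';
  holds_closed : forall w,
    (forall i w1, le w w1 -> (forall w', le w1 w' -> holds w' -> bp i w') -> bp i w1) ->
    holds w }.

Definition base (i : I) : Om.
Proof.
  refine (mkOm (bp i) _ _).
  - apply bp_mono.
  - intros w H. apply (H i w); auto.
Defined.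

(** The closure of the empty set of worlds: for it the premise of [holds_closed] is vacuous, so what
    remains is that all basic propositions hold from here on. *)
Definition bot : Om.
Proof.
  refine (mkOm (fun w => forall i w', le w w' -> bp i w') _ _).
  - intros w w' l H i w1 l1. eapply H, le_trans; eauto.
  - intros w H i w1 l1. apply H; auto.
Defined.

Definition conj (P Q : Om) : Om.
Proof.
  refine (mkOm (fun w => holds P w /\ holds Q w) _ _).
  - intros w w' l [H1 H2]; split; eapply holds_mono; eauto.
  - intros w H; split; apply holds_closed; intros i w1 l1 H1; apply H; auto;
      intros w' l' [H2 H3]; auto.
Defined.

Definition imp (P Q : Om) : Om.
Proof.
  refine (mkOm (fun w => forall w', le w w' -> holds P w' -> holds Q w') _ _).
  - intros w w' l H w1 l1. apply H. eauto.
  - intros w H w1 l1 HP. apply holds_closed. intros i w2 l2 H2.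
    apply H. { eauto. }
    intros w' l' H'. apply H2; auto. apply H'; auto.
    eapply holds_mono; [|eassumption]. eauto.
Defined.

Definition all {X : Type} (P : X -> Om) : Om.
Proof.
  refine (mkOm (fun w => forall x, holds (P x) w) _ _).
  - intros w w' l H x. eapply holds_mono; eauto.
  - intros w H x. apply holds_closed. intros i w1 l1 H1. apply H; auto.
Defined.

Definition ex {X : Type} (P : X -> Om) : Om.
Proof.
  refine (mkOm (fun w => forall i w1, le w w1 ->
    (forall w', le w1 w' -> forall x, holds (P x) w' -> bp i w') -> bp i w1) _ _).
  - intros w w' l H i w1 l1. apply H. eauto.
  - intros w H i w1 l1 H1. apply H; auto. intros w' l' H'. apply H'; auto.
    intros w2 l2. apply H1. eauto.
Defined.

Definition disj (P Q : Om) : Om := ex (fun b : bool => if b then P else Q).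
Definition iff (P Q : Om) : Om := conj (imp P Q) (imp Q P).

Lemma holds_imp P Q w : holds (imp P Q) w -> holds P w -> holds Q w.
Proof. intros H. apply H; auto. Qed.

Lemma holds_ex {X} (P : X -> Om) x w : holds (P x) w -> holds (ex P) w.
Proof.
  intros H i w1 l1 H1. apply (H1 w1 (le_refl _) x). eapply holds_mono; eauto.
Qed.

(** By definition [ex] eliminates only into basic propositions; the closedness of [Q] extends this
    to all truth values. *)
Lemma ex_elim {X} (P : X -> Om) Q w : holds (ex P) w ->
  (forall w', le w w' -> forall x, holds (P x) w' -> holds Q w') -> holds Q w.
Proof.
  intros H HQ. apply holds_closed. intros i w1 l1 H1. apply H; auto.
  intros w' l' x Hx. apply H1; auto. eapply HQ; eauto.
Qed.

Lemma bot_elim Q w : holds bot w -> holds Q w.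
Proof. intros H. apply holds_closed. intros i w1 l1 _. apply H; auto. Qed.

Lemma disj_l P Q w : holds P w -> holds (disj P Q) w.
Proof. apply (holds_ex (fun b : bool => if b then P else Q) true). Qed.

Lemma disj_r P Q w : holds Q w -> holds (disj P Q) w.
Proof. apply (holds_ex (fun b : bool => if b then P else Q) false). Qed.

Lemma disj_elim P Q R w : holds (disj P Q) w ->
  (forall w', le w w' -> holds P w' -> holds R w') ->
  (forall w', le w w' -> holds Q w' -> holds R w') -> holds R w.
Proof.
  intros H HP HQ. apply (ex_elim _ _ _ H). intros w' l [|]; auto.
Qed.

(** Moves the hypotheses to the later world and, where possible, forgets the earlier one, so that
    proofs read as intuitionistic deductions at one current world. *)
Ltac lift_to l :=
  match type of l with le ?w ?w' =>
    repeat match goal with H : holds _ w |- _ => apply (holds_mono _ _ _ l) in H end;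
    try clear l; try clear w
  end.
Ltac imp_intro H := let w := fresh "w" in let l := fresh "l" in
  intros w l H; lift_to l.
Ltac ex_destruct T x Hx :=
  let H := fresh in pose proof T as H;
  let w := fresh "w" in let l := fresh "l" in
  refine (ex_elim _ _ _ H _); clear H; try (is_var T; clear T);
  intros w l x Hx; lift_to l; cbv beta in Hx.
Ltac ex_here T x Hx := match goal with |- holds _ ?w => ex_destruct (T w) x Hx end.
Ltac assert_here H P := match goal with |- holds _ ?w => assert (H : holds P w) end.
Ltac disj_destruct T Hx :=
  let H := fresh in pose proof T as H;
  let w := fresh "w" in let l := fresh "l" in
  refine (disj_elim _ _ _ _ H _ _); clear H; try (is_var T; clear T);
  intros w l Hx; lift_to l.

(** * Satisfaction of formulas *)

Context (mem eq : D -> D -> Om).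

Fixpoint sat (A : form) (r : nat -> D) : Om :=
  match A with
  | Mem i j => mem (r i) (r j)
  | Eq i j => eq (r i) (r j)
  | Bot => bot
  | And A B => conj (sat A r) (sat B r)
  | Or A B => disj (sat A r) (sat B r)
  | Imp A B => imp (sat A r) (sat B r)
  | All A => all (fun x => sat A (x .: r))
  | Ex A => ex (fun x => sat A (x .: r))
  | BAll s A => all (fun x => imp (mem x (r s)) (sat A (x .: r)))
  | BEx s A => ex (fun x => conj (mem x (r s)) (sat A (x .: r)))
  end.

Lemma sat_unfold A : forall r, sat (unfold A) r = sat A r.
Proof.
  induction A; intros r; cbn; rewrite ?IHA1, ?IHA2; try reflexivity;
    f_equal; extensionality x; rewrite IHA; reflexivity.
Qed.

Lemma sat_rename A : forall s r, sat (rename s A) r = sat A (fun n => r (s n)).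
Proof.
  induction A; intros t r; cbn; rewrite ?IHA1, ?IHA2; try reflexivity;
    f_equal; extensionality x; rewrite IHA, scons_up; reflexivity.
Qed.

Definition bex (a : D) (P : D -> Om) : Om := ex (fun x => conj (mem x a) (P x)).
Definition ball (a : D) (P : D -> Om) : Om := all (fun x => imp (mem x a) (P x)).

Lemma equiv_conj P P' Q Q' :
  (forall w, holds P w <-> holds P' w) -> (forall w, holds Q w <-> holds Q' w) ->
  forall w, holds (conj P Q) w <-> holds (conj P' Q') w.
Proof. intros H1 H2 w; cbn. now rewrite H1, H2. Qed.
Lemma equiv_imp P P' Q Q' :
  (forall w, holds P w <-> holds P' w) -> (forall w, holds Q w <-> holds Q' w) ->
  forall w, holds (imp P Q) w <-> holds (imp P' Q') w.
Proof. intros H1 H2 w; cbn. split; intros H w' l Hp; apply H2, H, H1; auto. Qed.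
Lemma equiv_all {X} (P P' : X -> Om) :
  (forall x w, holds (P x) w <-> holds (P' x) w) ->
  forall w, holds (all P) w <-> holds (all P') w.
Proof. intros H1 w; cbn. split; intros H x; apply H1, H. Qed.
Lemma equiv_ex {X} (P P' : X -> Om) :
  (forall x w, holds (P x) w <-> holds (P' x) w) ->
  forall w, holds (ex P) w <-> holds (ex P') w.
Proof.
  intros H1 w; cbn. split; intros H i w1 l1 H2; apply H; auto; intros w' l' x Hx;
    eapply H2; eauto; apply H1; eauto.
Qed.


(** * Models of [IKP] and invariance under equality *)

Context (d0 : D)
  (ax : forall A, IKP A -> forall r w, holds (sat A r) w)
  (eq_r : forall x w, holds (eq x x) w)
  (eq_s : forall A r x y w, holds (eq x y) w ->
    holds (sat A (x .: r)) w -> holds (sat A (y .: r)) w).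

Lemma eq_sym x y w : holds (eq x y) w -> holds (eq y x) w.
Proof. intros H. exact (eq_s (Eq 0 1) (fun _ => x) x y w H (eq_r x w)). Qed.

Lemma mem_eq x x' y y' w : holds (eq x x') w -> holds (eq y y') w ->
  holds (mem x y) w -> holds (mem x' y') w.
Proof.
  intros H1 H2 H.
  apply (eq_s (Mem 1 0) (fun _ => x') y y' w H2).
  exact (eq_s (Mem 0 1) (fun _ => y) x x' w H1 H).
Qed.

Lemma eq_eq x x' y y' w : holds (eq x x') w -> holds (eq y y') w ->
  holds (eq x y) w -> holds (eq x' y') w.
Proof.
  intros H1 H2 H.
  apply (eq_s (Eq 1 0) (fun _ => x') y y' w H2).
  exact (eq_s (Eq 0 1) (fun _ => y) x x' w H1 H).
Qed.

Lemma all_eq_scons x r r' w : (forall i, holds (eq (r i) (r' i)) w) ->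
  forall i, holds (eq ((x .: r) i) ((x .: r') i)) w.
Proof. intros H [|i]; cbn; auto. Qed.

(** [eq_s] replaces one entry and an environment has infinitely many, so simultaneous replacement
    goes by induction on [A]. Symmetry serves antecedents and the bounds of universal
    quantifiers. *)
Lemma sat_eq A : forall r r' w, (forall i, holds (eq (r i) (r' i)) w) ->
  holds (sat A r) w -> holds (sat A r') w.
Proof.
  induction A; intros r r' w E H.
  - exact (mem_eq _ _ _ _ _ (E _) (E _) H).
  - exact (eq_eq _ _ _ _ _ (E _) (E _) H).
  - exact H.
  - split; [eapply IHA1 | eapply IHA2]; eauto; apply H.
  - apply (disj_elim _ _ _ _ H); intros w' l H';
      assert (E' : forall i, holds (eq (r i) (r' i)) w')
        by (intros i; eapply holds_mono; [exact l|apply E]);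
      [apply disj_l, (IHA1 r) | apply disj_r, (IHA2 r)]; assumption.
  - intros w' l H'. assert (E' : forall i, holds (eq (r i) (r' i)) w').
    { intros i; eapply holds_mono; eauto. }
    eapply IHA2; [exact E'|]. apply (H w' l). eapply IHA1; [|exact H'].
    intros i; apply eq_sym, E'.
  - intros x. eapply IHA; [|apply H]. now apply all_eq_scons.
  - apply (ex_elim _ _ _ H). intros w' l x Hx. apply (holds_ex _ x).
    eapply IHA; [|exact Hx]. apply all_eq_scons.
    intros i; eapply holds_mono; eauto.
  - intros x w' l Hx. assert (E' : forall i, holds (eq (r i) (r' i)) w').
    { intros i; eapply holds_mono; eauto. }
    eapply IHA; [|apply (H x w' l)]. now apply all_eq_scons.
    eapply mem_eq; [apply eq_r|apply eq_sym, E'|exact Hx].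
  - apply (ex_elim _ _ _ H). intros w' l x [Hm Hx]. apply (holds_ex _ x).
    assert (E' : forall i, holds (eq (r i) (r' i)) w').
    { intros i; eapply holds_mono; eauto. }
    split.
    + eapply mem_eq; [apply eq_r|apply E'|exact Hm].
    + eapply IHA; [|exact Hx]. now apply all_eq_scons.
Qed.

(** * Definability with parameters *)

Definition ev (t : nat + D) (v : nat -> D) : D :=
  match t with inl i => v i | inr d => d end.

(* Definability by a formula whose free variables are filled with entries of
   the environment or with parameters from [D]; [b = true] asks for a
   [Delta0] formula. *)
Definition Df (b : bool) (P : (nat -> D) -> Om) : Prop :=
  exists A f, (b = true -> Delta0 A) /\
    forall v w, holds (P v) w <-> holds (sat A (fun i => ev (f i) v)) w.

Lemma Df_ext b P P' : (forall v w, holds (P' v) w <-> holds (P v) w) ->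
  Df b P -> Df b P'.
Proof. intros E (A & f & H1 & H2). exists A, f; split; auto. intros; now rewrite E. Qed.

Lemma Df_weaken b P : Df true P -> Df b P.
Proof. intros (A & f & H1 & H2). exists A, f; auto. Qed.

Definition ev_subst (g : nat -> nat + D) (t : nat + D) : nat + D :=
  match t with inl j => g j | inr d => inr d end.

Lemma Df_subst b P g : Df b P -> Df b (fun v => P (fun i => ev (g i) v)).
Proof.
  intros (A & f & H1 & H2). exists A, (fun i => ev_subst g (f i)); split; auto.
  intros v w. rewrite H2. replace (fun i => ev (ev_subst g (f i)) v)
    with (fun i => ev (f i) (fun i0 => ev (g i0) v)); [easy|].
  extensionality i. now destruct (f i).
Qed.

Lemma Df_mem b s t : Df b (fun v => mem (ev s v) (ev t v)).
Proof. exists (Mem 0 1), (fun i => match i with 0 => s | _ => t end); cbn; easy. Qed.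

Lemma Df_eq b s t : Df b (fun v => eq (ev s v) (ev t v)).
Proof. exists (Eq 0 1), (fun i => match i with 0 => s | _ => t end); cbn; easy. Qed.

Lemma Df_bot b : Df b (fun v => bot).
Proof. exists Bot, (fun i => inl i); cbn; easy. Qed.

Lemma Df_sat b A (g : nat -> nat + D) : (b = true -> Delta0 A) ->
  Df b (fun v => sat A (fun i => ev (g i) v)).
Proof. intros H. exists A, g; split; [exact H|easy]. Qed.

Definition interleave {X} (f g : nat -> X) (n : nat) : X :=
  if Nat.even n then f (Nat.div2 n) else g (Nat.div2 n).

Lemma interleave_even {X} (f g : nat -> X) n : interleave f g (2 * n) = f n.
Proof. unfold interleave. now rewrite Nat.even_even, Nat.div2_double. Qed.

Lemma interleave_odd {X} (f g : nat -> X) n : interleave f g (S (2 * n)) = g n.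
Proof.
  unfold interleave. rewrite Nat.div2_succ_double.
  replace (S (2 * n)) with (2 * n + 1) by lia. now rewrite Nat.even_odd.
Qed.

(** The two definitions come with different fillings of their variables; moving one to even and the
    other to odd indices lets a single interleaved filling serve both. *)
Lemma Df_common b P Q : Df b P -> Df b Q -> exists A B f,
  (b = true -> Delta0 A) /\ (b = true -> Delta0 B) /\
  (forall v w, holds (P v) w <-> holds (sat A (fun i => ev (f i) v)) w) /\
  (forall v w, holds (Q v) w <-> holds (sat B (fun i => ev (f i) v)) w).
Proof.
  intros (A & f & H1 & H2) (B & g & H3 & H4).
  exists (rename (fun n => 2 * n) A), (rename (fun n => S (2 * n)) B), (interleave f g).
  split; [auto using Delta0_rename|]. split; [auto using Delta0_rename|].
  split; intros v w; rewrite sat_rename; [rewrite H2 | rewrite H4].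
  - replace (fun n => ev (interleave f g (2 * n)) v) with (fun n => ev (f n) v); [easy|].
    extensionality n. now rewrite interleave_even.
  - replace (fun n => ev (interleave f g (S (2 * n))) v) with (fun n => ev (g n) v); [easy|].
    extensionality n. now rewrite interleave_odd.
Qed.

Lemma Df_conj b P Q : Df b P -> Df b Q -> Df b (fun v => conj (P v) (Q v)).
Proof.
  intros HP HQ. destruct (Df_common _ _ _ HP HQ) as (A & B & f & H1 & H2 & H3 & H4).
  exists (And A B), f; split; [cbn; auto|]. intros v. cbn [sat]. apply equiv_conj; auto.
Qed.

Lemma equiv_disj P P' Q Q' :
  (forall w, holds P w <-> holds P' w) -> (forall w, holds Q w <-> holds Q' w) ->
  forall w, holds (disj P Q) w <-> holds (disj P' Q') w.
Proof. intros H1 H2. apply equiv_ex. intros [|]; auto. Qed.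

Lemma Df_disj b P Q : Df b P -> Df b Q -> Df b (fun v => disj (P v) (Q v)).
Proof.
  intros HP HQ. destruct (Df_common _ _ _ HP HQ) as (A & B & f & H1 & H2 & H3 & H4).
  exists (Or A B), f; split; [cbn; auto|]. intros v. cbn [sat]. apply equiv_disj; auto.
Qed.

Lemma Df_imp b P Q : Df b P -> Df b Q -> Df b (fun v => imp (P v) (Q v)).
Proof.
  intros HP HQ. destruct (Df_common _ _ _ HP HQ) as (A & B & f & H1 & H2 & H3 & H4).
  exists (Imp A B), f; split; [cbn; auto|]. intros v. cbn [sat]. apply equiv_imp; auto.
Qed.

(* Prepares a quantifier over entry 0: that entry becomes variable 0, and
   variable 1 is left free for the bounding term [t]. *)
Lemma Df_under b (P : D -> (nat -> D) -> Om) t :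
  Df b (fun v => P (v 0) (fun i => v (S i))) ->
  exists A f, (b = true -> Delta0 A) /\ f 0 = t /\
    forall x v w, holds (P x v) w <-> holds (sat A (x .: (fun i => ev (f i) v))) w.
Proof.
  intros (A & f & H1 & H2).
  (* Outside the quantifier the entries are numbered one lower. Variables filled with entry 0 have
     become variable 0, so at their old place [t] is only a filler. *)
  exists (rename (fun i => match f i with inl 0 => 0 | _ => S (S i) end) A),
    (fun i => match i with 0 => t | S i =>
       match f i with inl (S j) => inl j | inr d => inr d | inl 0 => t end end).
  split; [auto using Delta0_rename|]. split; [easy|].
  intros x v w. rewrite sat_rename. specialize (H2 (x .: v) w).
  cbn [scons] in H2. change (fun i => v i) with v in H2. rewrite H2.
  match goal with |- holds (sat _ ?r) _ <-> holds (sat _ ?r') _ =>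
    replace r' with r; [easy|] end.
  extensionality i. destruct (f i) as [[|j]|d] eqn:E; cbn; rewrite ?E; reflexivity.
Qed.

Lemma Df_ball b (P : D -> (nat -> D) -> Om) t :
  Df b (fun v => P (v 0) (fun i => v (S i))) ->
  Df b (fun v => ball (ev t v) (fun x => P x v)).
Proof.
  intros H. destruct (Df_under b P t H) as (A & f & H1 & H2 & H3).
  exists (BAll 0 A), f; split; [auto|]. intros v. cbn [sat]. rewrite H2.
  apply equiv_all. intros x. apply equiv_imp; [easy|]. apply H3.
Qed.

Lemma Df_bex b (P : D -> (nat -> D) -> Om) t :
  Df b (fun v => P (v 0) (fun i => v (S i))) ->
  Df b (fun v => bex (ev t v) (fun x => P x v)).
Proof.
  intros H. destruct (Df_under b P t H) as (A & f & H1 & H2 & H3).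
  exists (BEx 0 A), f; split; [auto|]. intros v. cbn [sat]. rewrite H2.
  apply equiv_ex. intros x. apply equiv_conj; [easy|]. apply H3.
Qed.

Lemma Df_all (P : D -> (nat -> D) -> Om) :
  Df false (fun v => P (v 0) (fun i => v (S i))) -> Df false (fun v => all (fun x => P x v)).
Proof.
  intros H. destruct (Df_under false P (inl 0) H) as (A & f & H1 & H2 & H3).
  exists (All A), f; split; [easy|]. intros v. cbn [sat]. apply equiv_all. auto.
Qed.

Lemma Df_ex (P : D -> (nat -> D) -> Om) :
  Df false (fun v => P (v 0) (fun i => v (S i))) -> Df false (fun v => ex (fun x => P x v)).
Proof.
  intros H. destruct (Df_under false P (inl 0) H) as (A & f & H1 & H2 & H3).
  exists (Ex A), f; split; [easy|]. intros v. cbn [sat]. apply equiv_ex. auto.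
Qed.

(** Needed because codes and their entries are determined only up to [eq]. *)
Lemma Df_resp b P v v' w : Df b P -> (forall i, holds (eq (v i) (v' i)) w) ->
  holds (P v) w -> holds (P v') w.
Proof.
  intros (A & f & H1 & H2) E H. apply H2. eapply sat_eq; [|apply H2, H].
  intros i. cbn. destruct (f i); cbn; auto.
Qed.

Lemma Df_unary b P : Df b (fun v => P (v 0)) -> exists A r, (b = true -> Delta0 A) /\
  forall x w, holds (P x) w <-> holds (sat A (x .: r)) w.
Proof.
  intros H. destruct (Df_under b (fun x _ => P x) (inl 0) H) as (A & f & H1 & H2 & H3).
  exists A, (fun i => ev (f i) (fun _ => d0)); split; auto.
Qed.

(** The two entries are exchanged to match the collection axiom, where the witness is variable 0 and
    the element of the bounding set variable 1. *)
Lemma Df_binary b P : Df b (fun v => P (v 0) (v 1)) ->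
  exists A r, (b = true -> Delta0 A) /\
  forall x y w, holds (P x y) w <-> holds (sat A (y .: x .: r)) w.
Proof.
  intros (A & f & H1 & H2).
  exists (rename (fun i => match f i with inl 0 => 1 | inl 1 => 0 | _ => S (S i) end) A),
    (fun i => ev (f i) (fun _ => d0)). split; [auto using Delta0_rename|].
  intros x y w. rewrite sat_rename.
  rewrite (H2 (x .: y .: (fun _ => d0)) w).
  match goal with |- holds (sat _ ?r) _ <-> holds (sat _ ?r') _ =>
    replace r' with r; [easy|] end.
  extensionality i. destruct (f i) as [[|[|j]]|d] eqn:E; cbn; rewrite ?E; reflexivity.
Qed.

(** * Set theory in the model *)

Lemma separation a P w : Df true (fun v => P (v 0)) ->
  holds (ex (fun b => all (fun x => iff (mem x b) (conj (mem x a) (P x))))) w.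
Proof.
  intros H. destruct (Df_unary true P H) as (A & r & H1 & H2).
  pose proof (ax _ (ikp_sep A (H1 Logic.eq_refl)) r w a) as H3. cbn [sat] in H3.
  ex_destruct H3 b Hb. apply (holds_ex _ b). intros x. specialize (Hb x). cbn in Hb.
  rewrite sat_rename in Hb. cbn. unfold shift_from in Hb.
  replace (fun n => (x .: b .: a .: r) (if n <? 1 then n else n + 2)) with (x .: r) in Hb.
  2:{ extensionality i. destruct i; cbn; [easy|]. now rewrite Nat.add_comm. }
  split; intros w' l Hx.
  - destruct (proj1 Hb w' l Hx) as [H4 H5]. split; [exact H4|]. now apply H2.
  - apply (proj2 Hb w' l). split; [apply Hx|]. apply H2, Hx.
Qed.

(** The axiom yields only a set containing both elements; separation cuts it down to them. *)
Lemma pairing a b w : holds (ex (fun c => all (fun x => iff (mem x c)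
  (disj (eq x a) (eq x b))))) w.
Proof.
  pose proof (ax _ ikp_pair (fun _ => d0) w a b) as H. cbn [sat] in H.
  ex_destruct H c Hc. destruct Hc as [Ha Hb]. cbn in Ha, Hb.
  assert (Hs : Df true (fun v => disj (eq (v 0) a) (eq (v 0) b))).
  { apply Df_disj; [apply (Df_eq _ (inl 0) (inr a)) | apply (Df_eq _ (inl 0) (inr b))]. }
  ex_destruct (separation c (fun x => disj (eq x a) (eq x b)) w0 Hs) d Hd.
  apply (holds_ex _ d). intros x. split; imp_intro H.
  - apply (holds_imp _ _ _ (proj1 (Hd x)) H).
  - apply (holds_imp _ _ _ (proj2 (Hd x))). split; [|exact H].
    disj_destruct H E; (eapply mem_eq; [apply eq_sym; exact E|apply eq_r|]); assumption.
Qed.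

Definition sub a b := ball a (fun x => mem x b).

Lemma sub_refl a w : holds (sub a a) w.
Proof. intros x w' l H; exact H. Qed.

Lemma sub_mem a b x w : holds (sub a b) w -> holds (mem x a) w -> holds (mem x b) w.
Proof. intros H. apply (holds_imp _ _ _ (H x)). Qed.

Lemma sub_trans a b c w : holds (sub a b) w -> holds (sub b c) w -> holds (sub a c) w.
Proof. intros H1 H2 x. imp_intro H. eauto using sub_mem. Qed.

Lemma union_bound a w : holds (ex (fun b => ball a (fun x => sub x b))) w.
Proof.
  pose proof (ax _ ikp_union (fun _ => d0) w a) as H. exact H.
Qed.

(** Directedness under inclusion: two bounds for relativisation can always be replaced by one larger
    bound. *)
Lemma upper_bound2 a b w : holds (ex (fun c => conj (sub a c) (sub b c))) w.
Proof.
  ex_here (pairing a b) p Hp. ex_here (union_bound p) c Hc.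
  apply (holds_ex _ c). split.
  - apply (holds_imp _ _ _ (Hc a)), (holds_imp _ _ _ (proj2 (Hp a))), disj_l, eq_r.
  - apply (holds_imp _ _ _ (Hc b)), (holds_imp _ _ _ (proj2 (Hp b))), disj_r, eq_r.
Qed.

Lemma singleton_bound a w : holds (ex (fun c => mem a c)) w.
Proof.
  ex_here (pairing a a) p Hp. apply (holds_ex _ p).
  apply (holds_imp _ _ _ (proj2 (Hp a))), disj_l, eq_r.
Qed.

Lemma induction P w : Df false (fun v => P (v 0)) ->
  holds (all (fun x => imp (ball x P) (P x))) w -> holds (all P) w.
Proof.
  intros H HP. destruct (Df_unary false P H) as (A & r & _ & H2).
  pose proof (ax _ (ikp_ind A) r w) as H3.
  intros x. apply H2. cut (holds (sat (All A) r) w). { intros H4; apply H4. }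
  apply (holds_imp _ _ _ H3). clear x. intros x. cbn. intros w1 l1 H4.
  apply H2. apply (HP x w1 l1). intros y w2 l2 Hy. apply H2.
  specialize (H4 y w2 l2 Hy). rewrite sat_rename in H4.
  replace (y .: r) with (fun n => (y .: x .: r) (shift_from 1 1 n)); [exact H4|].
  extensionality i; unfold shift_from; destruct i; cbn; [easy|]. now rewrite Nat.add_comm.
Qed.

Lemma collection a P w : Df true (fun v => P (v 0) (v 1)) ->
  holds (ball a (fun x => ex (P x))) w ->
  holds (ex (fun b => ball a (fun x => bex b (P x)))) w.
Proof.
  intros H HP. destruct (Df_binary true P H) as (A & r & H1 & H2).
  pose proof (ax _ (ikp_coll A (H1 Logic.eq_refl)) r w a w (le_refl w)) as H3.
  assert (E1 : forall x y, (fun n => (y .: x .: a .: r) (shift_from 2 1 n)) = y .: x .: r).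
  { intros x y. extensionality i. unfold shift_from.
    destruct i as [|[|i]]; cbn; [easy|easy|]. now rewrite Nat.add_comm. }
  assert (E2 : forall x y b,
    (fun n => (y .: x .: b .: a .: r) (shift_from 2 2 n)) = y .: x .: r).
  { intros x y b. extensionality i. unfold shift_from.
    destruct i as [|[|i]]; cbn; [easy|easy|]. now rewrite Nat.add_comm. }
  cbn [sat] in H3. refine (ex_elim _ _ _ (H3 _) _).
  - intros x w1 l1 Hx. pose proof (HP x w1 l1 Hx) as H4. clear - H4 H2 E1 le_refl le_trans.
    ex_destruct H4 y Hy. apply (holds_ex _ y). rewrite sat_rename, E1. now apply H2.
  - clear - H2 E2 le_refl le_trans. intros w1 _ b Hb. apply (holds_ex _ b).
    intros x w2 l2 Hx. pose proof (Hb x w2 l2 Hx) as H4. clear - H4 H2 E2 le_refl le_trans.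
    ex_destruct H4 y Hy. destruct Hy as [Hy1 Hy2]. apply (holds_ex _ y). split; [exact Hy1|].
    rewrite sat_rename, E2 in Hy2. now apply H2.
Qed.

(** Collection gives a set of bounds containing a suitable one for each [x]; its union contains them
    all, and by monotonicity it works for every [x]. *)
Lemma bounding a P w : Df true (fun v => P (v 0) (v 1)) ->
  (forall x z z' w, holds (sub z z') w -> holds (P x z) w -> holds (P x z') w) ->
  holds (ball a (fun x => ex (P x))) w ->
  holds (ex (fun z => ball a (fun x => P x z))) w.
Proof.
  intros H Hm HP. pose proof (collection a P w H HP) as H1.
  ex_destruct H1 b Hb. ex_here (union_bound b) c Hc. apply (holds_ex _ c).
  intros x. imp_intro Hx. pose proof (holds_imp _ _ _ (Hb x) Hx) as Hz.
  ex_destruct Hz z Hz'. destruct Hz' as [Hz1 Hz2].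
  apply (Hm x z c); [|exact Hz2]. apply (holds_imp _ _ _ (Hc z) Hz1).
Qed.

(* A truth value is coded by the set of those elements of some inhabited set
   for which it holds; collection over that set bounds a witness that exists
   only under the hypothesis [Q]. *)
Lemma imp_bounding Q P w : Df true (fun _ => Q) -> Df true (fun v => P (v 0)) ->
  (forall z z' w, holds (sub z z') w -> holds (P z) w -> holds (P z') w) ->
  holds (imp Q (ex P)) w -> holds (ex (fun z => imp Q (P z))) w.
Proof.
  intros HQ HP Hm H. ex_here (singleton_bound d0) s Hs.
  ex_destruct (separation s (fun _ => Q) w0 HQ) a Ha.
  assert_here H1 (ball a (fun x => ex P)).
  { intros x. imp_intro Hx. apply (holds_imp _ _ _ H).
    apply (holds_imp _ _ _ (proj1 (Ha x)) Hx). }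
  assert (H2 : Df true (fun v => P (v 1))).
  { apply (Df_subst _ (fun v => P (v 0)) (fun _ => inl 1) HP). }
  pose proof (bounding a (fun _ => P) w H2 (fun _ => Hm) H1) as H3.
  ex_destruct H3 z Hz. apply (holds_ex _ z). imp_intro H4.
  apply (holds_imp _ _ _ (Hz d0)). apply (holds_imp _ _ _ (proj2 (Ha d0))). now split.
Qed.

(** * Relativisation *)

(* [rel] with the bound [z] kept outside of the environment. *)
Fixpoint satz (A : form) (z : D) (r : nat -> D) : Om :=
  match A with
  | Mem i j => mem (r i) (r j)
  | Eq i j => eq (r i) (r j)
  | Bot => bot
  | And A B => conj (satz A z r) (satz B z r)
  | Or A B => disj (satz A z r) (satz B z r)
  | Imp A B => imp (satz A z r) (satz B z r)
  | All A => ball z (fun x => satz A z (x .: r))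
  | Ex A => bex z (fun x => satz A z (x .: r))
  | BAll s A => ball (r s) (fun x => satz A z (x .: r))
  | BEx s A => bex (r s) (fun x => satz A z (x .: r))
  end.

(** The renaming [s] is general because it changes together with [k] under quantifiers; the intended
    instance is [lift A] with bound 0. *)
Lemma sat_rel A : forall k s r,
  sat (rel (rename s A) k) r = satz A (r k) (fun n => r (s n)).
Proof.
  induction A; intros k t r; cbn; rewrite ?IHA1, ?IHA2; try reflexivity;
    unfold ball, bex; f_equal; extensionality x; rewrite IHA, scons_up; reflexivity.
Qed.

Lemma satz_Delta0 A : Delta0 A -> forall z r, satz A z r = sat A r.
Proof.
  induction A; cbn; intros H z r; try contradiction; rewrite ?IHA1, ?IHA2 by apply H;
    try reflexivity; unfold ball, bex; f_equal; extensionality x; rewrite IHA; auto.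
Qed.

Lemma satz_ext A : forall n z r r', fv_below n A -> (forall i, i < n -> r i = r' i) ->
  satz A z r = satz A z r'.
Proof.
  assert (Hs : forall n (r r' : nat -> D) x, (forall i, i < n -> r i = r' i) ->
    forall i, i < S n -> (x .: r) i = (x .: r') i).
  { intros n r r' x H [|i] Hi; cbn; auto. apply H; lia. }
  induction A; cbn; intros k z r r' Hfv H.
  1,2: rewrite (H n), (H n0) by lia; reflexivity.
  1: reflexivity.
  1-3: f_equal; [apply (IHA1 k) | apply (IHA2 k)]; tauto.
  1,2: unfold ball, bex; f_equal; extensionality x; f_equal;
    apply (IHA (S k)); [tauto|now apply Hs].
  1,2: rewrite (H n) by lia; unfold ball, bex; f_equal; extensionality x; f_equal;
    apply (IHA (S k)); [tauto|now apply Hs].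
Qed.

Lemma Df_satz b A (g : nat -> nat + D) t :
  Df b (fun v => satz A (ev t v) (fun i => ev (g i) v)).
Proof.
  apply Df_weaken.
  eapply Df_ext; [|apply (Df_sat true (rel (rename S A) 0) (t .: g)); intros _; apply Delta0_rel].
  intros v w. cbv beta. rewrite sat_rel. reflexivity.
Qed.

Lemma Df_satz_scons b A t s r : Df b (fun v => satz A (ev t v) (ev s v .: r)).
Proof.
  eapply Df_ext; [|apply (Df_satz b A (s .: (fun i => inr (r i))) t)].
  intros v w. replace (ev s v .: r) with (fun i => ev ((s .: (fun i => inr (r i))) i) v);
    [easy|]. extensionality i; now destruct i.
Qed.

Definition mono (X : D -> Om) : Prop :=
  forall z z' w, holds (sub z z') w -> holds (X z) w -> holds (X z') w.

Definition anti (X : D -> Om) : Prop :=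
  forall z z' w, holds (sub z z') w -> holds (X z') w -> holds (X z) w.

Lemma mono_const P : mono (fun _ => P).
Proof. intros z z' w _ H; exact H. Qed.

Lemma mono_conj X Y : mono X -> mono Y -> mono (fun z => conj (X z) (Y z)).
Proof. intros H1 H2 z z' w Hs [H3 H4]. split; [eapply H1|eapply H2]; eauto. Qed.

Lemma anti_conj X Y : anti X -> anti Y -> anti (fun z => conj (X z) (Y z)).
Proof. intros H1 H2 z z' w Hs [H3 H4]. split; [eapply H1|eapply H2]; eauto. Qed.

Lemma mono_disj X Y : mono X -> mono Y -> mono (fun z => disj (X z) (Y z)).
Proof.
  intros H1 H2 z z' w Hs H. disj_destruct H H; [apply disj_l|apply disj_r]; eauto.
Qed.

Lemma anti_disj X Y : anti X -> anti Y -> anti (fun z => disj (X z) (Y z)).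
Proof.
  intros H1 H2 z z' w Hs H. disj_destruct H H; [apply disj_l|apply disj_r]; eauto.
Qed.

Lemma mono_imp X Y : anti X -> mono Y -> mono (fun z => imp (X z) (Y z)).
Proof.
  intros H1 H2 z z' w Hs H. imp_intro Hx. apply (H2 z); auto.
  apply (holds_imp _ _ _ H). eauto.
Qed.

Lemma anti_imp X Y : mono X -> anti Y -> anti (fun z => imp (X z) (Y z)).
Proof.
  intros H1 H2 z z' w Hs H. imp_intro Hx. apply (H2 z z'); auto.
  apply (holds_imp _ _ _ H). eauto.
Qed.

Lemma mono_ball a X : (forall x, mono (X x)) -> mono (fun z => ball a (fun x => X x z)).
Proof.
  intros H1 z z' w Hs H x. imp_intro Hx. apply (H1 x z); auto.
  apply (holds_imp _ _ _ (H x)); auto.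
Qed.

Lemma anti_ball a X : (forall x, anti (X x)) -> anti (fun z => ball a (fun x => X x z)).
Proof.
  intros H1 z z' w Hs H x. imp_intro Hx. apply (H1 x z z'); auto.
  apply (holds_imp _ _ _ (H x)); auto.
Qed.

Lemma mono_bex a X : (forall x, mono (X x)) -> mono (fun z => bex a (fun x => X x z)).
Proof.
  intros H1 z z' w Hs H. ex_destruct H x Hx. destruct Hx. apply (holds_ex _ x).
  split; auto. eapply H1; eauto.
Qed.

Lemma anti_bex a X : (forall x, anti (X x)) -> anti (fun z => bex a (fun x => X x z)).
Proof.
  intros H1 z z' w Hs H. ex_destruct H x Hx. destruct Hx. apply (holds_ex _ x).
  split; auto. eapply H1; eauto.
Qed.

(** A larger bound offers more witnesses and more counterexamples, so Sigma-formulas persist upwards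
    and Pi-formulas downwards. Implication exchanges the classes, hence the simultaneous
    induction. *)
Lemma satz_mono :
  (forall A, Sigma A -> forall r, mono (fun z => satz A z r)) /\
  (forall A, Pi A -> forall r, anti (fun z => satz A z r)).
Proof.
  apply Sigma_Pi_mutind; cbn; intros.
  - intros z z' w _. now rewrite !satz_Delta0.
  - now apply mono_conj.
  - now apply mono_disj.
  - now apply (mono_ball _ (fun x z => satz A z (x .: r))).
  - now apply (mono_bex _ (fun x z => satz A z (x .: r))).
  - intros z z' w Hs Hz. ex_destruct Hz x Hx. destruct Hx. apply (holds_ex _ x).
    split; [eapply sub_mem; eauto|]. eapply H0; eauto.
  - now apply mono_imp.
  - apply mono_imp; auto. apply mono_const.
  - intros z z' w _. now rewrite !satz_Delta0.
  - now apply anti_conj.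
  - now apply anti_disj.
  - now apply (anti_ball _ (fun x z => satz A z (x .: r))).
  - now apply (anti_bex _ (fun x z => satz A z (x .: r))).
  - intros z z' w Hs Hz x. imp_intro Hx. eapply H0; eauto.
    apply (holds_imp _ _ _ (Hz x)). eapply sub_mem; eauto.
  - now apply anti_imp.
  - apply anti_imp; auto. intros z z' w _ Hz; exact Hz.
Qed.

(** The limit case of [satz_mono]: the universe acts as a bound above every [z]. *)
Lemma satz_sat :
  (forall A, Sigma A -> forall z r w, holds (satz A z r) w -> holds (sat A r) w) /\
  (forall A, Pi A -> forall z r w, holds (sat A r) w -> holds (satz A z r) w).
Proof.
  apply Sigma_Pi_mutind; cbn [sat satz Neg]; intros.
  - now rewrite satz_Delta0 in H0.
  - destruct H3. split; eauto.
  - disj_destruct H3 H3; [apply disj_l|apply disj_r]; eauto.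
  - intros x. imp_intro Hx. eapply H0, (holds_imp _ _ _ (H1 x) Hx).
  - ex_destruct H1 x Hx. destruct Hx. apply (holds_ex _ x). split; eauto.
  - ex_destruct H1 x Hx. destruct Hx. apply (holds_ex _ x). eauto.
  - imp_intro Hx. eapply H2, (holds_imp _ _ _ H3). auto.
  - imp_intro Hx. eapply (holds_imp _ _ _ H1). auto.
  - now rewrite satz_Delta0.
  - destruct H3. split; eauto.
  - disj_destruct H3 H3; [apply disj_l|apply disj_r]; eauto.
  - intros x. imp_intro Hx. eapply H0, (holds_imp _ _ _ (H1 x) Hx).
  - ex_destruct H1 x Hx. destruct Hx. apply (holds_ex _ x). split; eauto.
  - intros x. imp_intro Hx. apply H0. apply H1.
  - imp_intro Hx. eapply H2, (holds_imp _ _ _ H3). eauto.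
  - imp_intro Hx. eapply (holds_imp _ _ _ H1). eauto.
Qed.

(** * Forcing *)

Section Forcing.
(* [T p z]: the condition [p] relativised to [z]; [E e z]: the answer [e] relativised
   to [z]. The order on conditions is reverse inclusion. *)
Context (T E : D -> D -> Om) (L : list form)
  (Df_T : Df true (fun v => T (v 0) (v 1))) (Df_E : Df true (fun v => E (v 0) (v 1)))
  (T_sub : forall p q z w, holds (sub p q) w -> holds (T q z) w -> holds (T p z) w)
  (T_anti : forall p, anti (T p)) (E_mono : forall e, mono (E e))
  (top_ex : forall w, holds (ex (fun p => all (fun z => T p z))) w)
  (cond_ex : forall A, In A L -> Pi A -> forall r p w, holds (ex (fun q => conj (sub p q)
     (all (fun z => iff (T q z) (conj (T p z) (satz A z r)))))) w)
  (ans_ex : forall A, In A L -> Sigma A -> forall r w,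
     holds (ex (fun e => all (fun z => iff (E e z) (satz A z r)))) w)
  (L_inhabited : In (BEx 0 (Eq 0 0)) L).

Lemma Df_T' b s t : Df b (fun v => T (ev s v) (ev t v)).
Proof. apply Df_weaken, (Df_subst _ _ (s .: t .: inl) Df_T). Qed.

Lemma Df_E' b s t : Df b (fun v => E (ev s v) (ev t v)).
Proof. apply Df_weaken, (Df_subst _ _ (s .: t .: inl) Df_E). Qed.

(** The formula says that its parameter is inhabited. Separating by [Q] from an inhabited set turns
    [Q] into inhabitedness, so this one formula in [L] makes every Delta0 truth value available to
    conditions and answers. *)
Lemma truth_value Q w : Df true (fun _ => Q) ->
  holds (ex (fun t => iff (sat (BEx 0 (Eq 0 0)) (fun _ => t)) Q)) w.
Proof.
  intros HQ. ex_here (singleton_bound d0) s Hs.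
  ex_destruct (separation s (fun _ => Q) w0 HQ) t Ht. apply (holds_ex _ t).
  cbn [sat]. split; imp_intro H.
  - ex_destruct H x Hx. destruct Hx as [Hx _].
    apply (holds_imp _ _ _ (proj1 (Ht x)) Hx).
  - apply (holds_ex _ d0). split; [|apply eq_r].
    apply (holds_imp _ _ _ (proj2 (Ht d0))). now split.
Qed.

Lemma inhabited_Delta0 : Delta0 (BEx 0 (Eq 0 0)).
Proof. exact Logic.I. Qed.

Lemma cond_truth Q p w : Df true (fun _ => Q) ->
  holds (ex (fun q => conj (sub p q) (all (fun z => iff (T q z) (conj (T p z) Q))))) w.
Proof.
  intros HQ. ex_destruct (truth_value Q w HQ) t Ht.
  ex_destruct (cond_ex _ L_inhabited (Pi_D0 _ inhabited_Delta0) (fun _ => t) p w0) q Hq.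
  destruct Hq as [Hq1 Hq2].
  apply (holds_ex _ q). split; [exact Hq1|]. intros z. specialize (Hq2 z). cbv beta in Hq2.
  rewrite satz_Delta0 in Hq2 by exact inhabited_Delta0.
  split; imp_intro H.
  - pose proof (holds_imp _ _ _ (proj1 Hq2) H) as [H1 H2]. split; [exact H1|].
    apply (holds_imp _ _ _ (proj1 Ht) H2).
  - destruct H as [H1 H2]. apply (holds_imp _ _ _ (proj2 Hq2)). split; [exact H1|].
    apply (holds_imp _ _ _ (proj2 Ht) H2).
Qed.

Lemma ans_truth Q w : Df true (fun _ => Q) ->
  holds (ex (fun e => all (fun z => iff (E e z) Q))) w.
Proof.
  intros HQ. ex_destruct (truth_value Q w HQ) t Ht.
  ex_destruct (ans_ex _ L_inhabited (Sig_D0 _ inhabited_Delta0) (fun _ => t) w0) e He.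
  apply (holds_ex _ e). intros z. specialize (He z). cbv beta in He.
  rewrite satz_Delta0 in He by exact inhabited_Delta0.
  split; imp_intro H.
  - apply (holds_imp _ _ _ (proj1 Ht)), (holds_imp _ _ _ (proj1 He) H).
  - apply (holds_imp _ _ _ (proj2 He)), (holds_imp _ _ _ (proj2 Ht) H).
Qed.

(** Local truth at [p]: hypothesis and conclusion share the bound. As [T] is antitone in [z], for
    monotone [X] every larger bound serves as well. *)
Definition N (p : D) (X : D -> Om) : Om := ex (fun z => imp (T p z) (X z)).

Lemma N_intro p X z w : holds (X z) w -> holds (N p X) w.
Proof. intros H. apply (holds_ex _ z). intros w' l _. eapply holds_mono; eauto. Qed.

Lemma N_sub p q X w : holds (sub p q) w -> holds (N p X) w -> holds (N q X) w.
Proof.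
  intros H1 H2. ex_destruct H2 z Hz. apply (holds_ex _ z). imp_intro H3.
  apply (holds_imp _ _ _ Hz). eauto.
Qed.

Lemma N_map p X Y w : holds (all (fun z => imp (X z) (Y z))) w ->
  holds (N p X) w -> holds (N p Y) w.
Proof.
  intros H H1. ex_destruct H1 z Hz. apply (holds_ex _ z). imp_intro H3.
  apply (holds_imp _ _ _ (H z)), (holds_imp _ _ _ Hz H3).
Qed.

Lemma N_conj p X Y w : mono X -> mono Y -> holds (N p X) w -> holds (N p Y) w ->
  holds (N p (fun z => conj (X z) (Y z))) w.
Proof.
  intros HX HY H1 H2. ex_destruct H1 z Hz. ex_destruct H2 z' Hz'.
  ex_here (upper_bound2 z z') u Hu. destruct Hu as [Hu1 Hu2].
  apply (holds_ex _ u). imp_intro H3. split.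
  - apply (HX z); auto. apply (holds_imp _ _ _ Hz), (T_anti p z u); auto.
  - apply (HY z'); auto. apply (holds_imp _ _ _ Hz'), (T_anti p z' u); auto.
Qed.

(** [imp_bounding] pulls the inner bound out of the scope of [T p z]; a common upper bound then
    replaces both. *)
Lemma N_idem p X w : Df true (fun v => X (v 0)) -> mono X ->
  holds (ex (fun z => imp (T p z) (N p X))) w -> holds (N p X) w.
Proof.
  intros HX HM H. ex_destruct H z Hz.
  assert_here H1 (ex (fun z' => imp (T p z) (imp (T p z') (X z')))).
  { apply imp_bounding; [apply (Df_T' _ (inr p) (inr z))| | |exact Hz].
    - apply Df_imp; [apply (Df_T' _ (inr p) (inl 0))|exact HX].
    - apply mono_imp; auto. }
  ex_destruct H1 z' Hz'. ex_here (upper_bound2 z z') u Hu. destruct Hu as [Hu1 Hu2].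
  apply (holds_ex _ u). imp_intro H2. apply (HM z'); auto.
  apply (holds_imp (T p z')); [apply (holds_imp _ _ _ Hz')|]; eapply T_anti; eauto.
Qed.

Lemma N_ball p a X w : Df true (fun v => X (v 0) (v 1)) -> (forall x, mono (X x)) ->
  holds (ball a (fun x => N p (X x))) w -> holds (N p (fun z => ball a (fun x => X x z))) w.
Proof.
  intros HX HM H.
  assert_here H1 (ex (fun z => ball a (fun x => imp (T p z) (X x z)))).
  { apply (bounding a (fun x z => imp (T p z) (X x z))); [| |exact H].
    - apply Df_imp; [apply (Df_T' _ (inr p) (inl 1))|exact HX].
    - intros x. apply (mono_imp (T p) (X x)); auto. }
  ex_destruct H1 z Hz. apply (holds_ex _ z). imp_intro H2. intros x. imp_intro Hx.
  apply (holds_imp (T p z)); auto. apply (holds_imp _ _ _ (Hz x) Hx).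
Qed.

(** An equivalence, so that [q] adds [R] and nothing more to [p]; this exactness is what allows [R]
    to be discharged later. *)
Definition extends (q p : D) (R : D -> Om) : Om :=
  conj (sub p q) (all (fun z => iff (T q z) (conj (T p z) (R z)))).

Lemma extends_forces q p R z w : holds (extends q p R) w ->
  holds (T q z) w -> holds (R z) w.
Proof. intros [_ H] H1. apply (holds_imp _ _ _ (proj1 (H z)) H1). Qed.

(** A deduction theorem for local truth: what holds under [p] together with [R] becomes an
    implication under [p]. *)
Lemma N_extends p R X w : holds (ex (fun q => extends q p R)) w ->
  holds (all (fun q => imp (extends q p R) (N q X))) w ->
  holds (N p (fun z => imp (R z) (X z))) w.
Proof.
  intros H H1. ex_destruct H q Hq. pose proof (holds_imp _ _ _ (H1 q) Hq) as H2.
  destruct Hq as [_ Hq]. ex_destruct H2 z Hz. apply (holds_ex _ z).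
  imp_intro H3. imp_intro H4. apply (holds_imp _ _ _ Hz).
  apply (holds_imp _ _ _ (proj2 (Hq z))). now split.
Qed.

(* Existentials are read through continuations with answers [e]; since [N _ (E e)]
   absorbs [N], so does every forced formula. *)
Definition cps (S : D -> Om) (p : D) : Om :=
  all (fun q => imp (sub p q) (all (fun e =>
    imp (all (fun r => imp (sub q r) (imp (S r) (N r (E e))))) (N q (E e))))).

Lemma cps_intro S p w : (forall q w', le w w' -> holds (sub p q) w' -> holds (S q) w') ->
  holds (cps S p) w.
Proof.
  intros H q. intros w1 l1 Hq e. intros w2 l2 H2. apply (H2 q w2 (le_refl _)).
  - apply sub_refl.
  - apply le_refl.
  - eapply holds_mono; [|apply H]; eauto.
Qed.

Lemma cps_sub S p q w : holds (sub p q) w -> holds (cps S p) w -> holds (cps S q) w.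
Proof.
  intros H1 H2 q'. imp_intro Hq. apply (holds_imp _ _ _ (H2 q')).
  eapply sub_trans; eauto.
Qed.

(** Continuations end in answers, so [cps] eliminates into local truth of anything that an answer
    codes. *)
Lemma cps_N S p X w : holds (ex (fun e => all (fun z => iff (E e z) (X z)))) w ->
  holds (cps S p) w -> holds (all (fun q => imp (sub p q) (imp (S q) (N q X)))) w ->
  holds (N p X) w.
Proof.
  intros He HS H. ex_destruct He e He'.
  apply (N_map p (E e)). { intros z. apply (proj1 (He' z)). }
  apply (fun H' => holds_imp _ _ _ (holds_imp _ _ _ (HS p) (sub_refl p _) e) H').
  intros q. imp_intro Hq. imp_intro Hs. apply (N_map q X).
  { intros z. apply (proj2 (He' z)). }
  apply (holds_imp _ _ _ (holds_imp _ _ _ (H q) Hq) Hs).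
Qed.

(** * The forcing relation and its closure properties *)

Fixpoint force (A : form) (p : D) (r : nat -> D) : Om :=
  match A with
  | Mem i j => N p (fun _ => mem (r i) (r j))
  | Eq i j => N p (fun _ => eq (r i) (r j))
  | Bot => N p (fun _ => bot)
  | And A B => conj (force A p r) (force B p r)
  | Or A B => cps (fun q => disj (force A q r) (force B q r)) p
  | Imp A B => all (fun q => imp (sub p q) (imp (force A q r) (force B q r)))
  | All A => all (fun x => force A p (x .: r))
  | Ex A => cps (fun q => ex (fun x => force A q (x .: r))) p
  | BAll s A => all (fun x => all (fun q => imp (sub p q)
      (imp (N q (fun _ => mem x (r s))) (force A q (x .: r)))))
  | BEx s A => cps (fun q => ex (fun x =>
      conj (N q (fun _ => mem x (r s))) (force A q (x .: r)))) p
  end.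

(** The clauses for bounded quantifiers were chosen to be those of their unfoldings, since
    derivations see unfolded formulas only. *)
Lemma force_unfold A : forall p r, force (unfold A) p r = force A p r.
Proof.
  assert (HE : forall S S' p, (forall q, S q = S' q) -> cps S p = cps S' p).
  { intros S S' p H. f_equal. extensionality q. apply H. }
  induction A; intros p r; cbn; rewrite ?IHA1, ?IHA2; try reflexivity.
  - apply HE. intros q. now rewrite IHA1, IHA2.
  - f_equal. extensionality q. now rewrite IHA1, IHA2.
  - f_equal. extensionality x. now rewrite IHA.
  - apply HE. intros q. f_equal. extensionality x. now rewrite IHA.
  - f_equal. extensionality x. f_equal. extensionality q. now rewrite IHA.
  - apply HE. intros q. f_equal. extensionality x. now rewrite IHA.
Qed.

Lemma force_rename A : forall s p r, force (rename s A) p r = force A p (fun n => r (s n)).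
Proof.
  assert (HE : forall S S' p, (forall q, S q = S' q) -> cps S p = cps S' p).
  { intros S S' p H. f_equal. extensionality q. apply H. }
  induction A; intros t p r; cbn; rewrite ?IHA1, ?IHA2; try reflexivity.
  - apply HE. intros q. now rewrite IHA1, IHA2.
  - f_equal. extensionality q. now rewrite IHA1, IHA2.
  - f_equal. extensionality x. now rewrite IHA, scons_up.
  - apply HE. intros q. f_equal. extensionality x. now rewrite IHA, scons_up.
  - f_equal. extensionality x. f_equal. extensionality q. now rewrite IHA, scons_up.
  - apply HE. intros q. f_equal. extensionality x. now rewrite IHA, scons_up.
Qed.

Lemma force_sub A : forall p q r w, holds (sub p q) w -> holds (force A p r) w ->
  holds (force A q r) w.
Proof.
  induction A; intros p q r w Hs H; cbn [force] in *; eauto using N_sub, cps_sub.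
  - destruct H. split; eauto.
  - intros q'. imp_intro Hq. apply (holds_imp _ _ _ (H q')). eapply sub_trans; eauto.
  - intros x. exact (IHA _ _ _ _ Hs (H x)).
  - intros x q'. imp_intro Hq. apply (holds_imp _ _ _ (H x q')). eapply sub_trans; eauto.
Qed.

Lemma cps_absorb S p w : holds (ex (fun z => imp (T p z) (cps S p))) w -> holds (cps S p) w.
Proof.
  intros H q. imp_intro Hq. intros e. imp_intro He.
  apply N_idem; [apply (Df_E' _ (inr e) (inl 0))|auto|].
  ex_destruct H z Hz. apply (holds_ex _ z). imp_intro Ht.
  pose proof (holds_imp _ _ _ Hz (T_sub _ _ _ _ Hq Ht)) as H1.
  apply (holds_imp _ _ _ (holds_imp _ _ _ (H1 q) Hq e) He).
Qed.

(** For atoms this is [N_idem]; disjunction and existence absorb because their answers do; the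
    remaining connectives inherit it from their components. *)
Lemma force_absorb A : forall p r w,
  holds (ex (fun z => imp (T p z) (force A p r))) w -> holds (force A p r) w.
Proof.
  induction A; intros p r w H; cbn [force] in *;
    try match goal with |- holds (cps _ _) _ => exact (cps_absorb _ _ _ H) end.
  1-3: apply N_idem; [|apply mono_const|exact H].
  - apply (Df_mem _ (inr (r n)) (inr (r n0))).
  - apply (Df_eq _ (inr (r n)) (inr (r n0))).
  - apply Df_bot.
  - split; [apply IHA1|apply IHA2]; ex_destruct H z Hz; apply (holds_ex _ z); imp_intro Ht;
      apply (holds_imp _ _ _ Hz Ht).
  - intros q. imp_intro Hq. imp_intro HA. apply IHA2. ex_destruct H z Hz.
    apply (holds_ex _ z). imp_intro Ht.
    pose proof (holds_imp _ _ _ Hz (T_sub _ _ _ _ Hq Ht)) as H1.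
    apply (holds_imp _ _ _ (holds_imp _ _ _ (H1 q) Hq) HA).
  - intros x. apply IHA. ex_destruct H z Hz.
    apply (holds_ex _ z). imp_intro Ht. apply (holds_imp _ _ _ Hz Ht).
  - intros x q. imp_intro Hq. imp_intro HA. apply IHA. ex_destruct H z Hz.
    apply (holds_ex _ z). imp_intro Ht.
    pose proof (holds_imp _ _ _ Hz (T_sub _ _ _ _ Hq Ht)) as H1.
    apply (holds_imp _ _ _ (holds_imp _ _ _ (H1 x q) Hq) HA).
Qed.

(** A fact known only locally at [p] may be used as if it were true when something is to be forced
    by [p]. *)
Lemma force_N_elim A p r Q w : holds (N p (fun _ => Q)) w ->
  holds (imp Q (force A p r)) w -> holds (force A p r) w.
Proof.
  intros H1 H2. apply force_absorb. ex_destruct H1 z Hz. apply (holds_ex _ z).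
  imp_intro Ht. apply (holds_imp _ _ _ H2), (holds_imp _ _ _ Hz Ht).
Qed.

(** Atoms are reached through an answer coding their truth value, disjunction and existence by
    composing continuations, the rest componentwise. This validates the elimination rules for
    disjunction and existence. *)
Lemma cps_elim A S : forall p r w, holds (cps S p) w ->
  holds (all (fun q => imp (sub p q) (imp (S q) (force A q r)))) w ->
  holds (force A p r) w.
Proof.
  assert (HC : forall S' p w, holds (cps S p) w ->
    holds (all (fun q => imp (sub p q) (imp (S q) (cps S' q)))) w -> holds (cps S' p) w).
  { intros S' p w H1 H2 q. imp_intro Hq. intros e. imp_intro He.
    apply (fun H' => holds_imp _ _ _ (holds_imp _ _ _ (H1 q) Hq e) H').
    intros q'. imp_intro Hq'. imp_intro HS.
    pose proof (sub_trans _ _ _ _ Hq Hq') as Hq2.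
    pose proof (holds_imp _ _ _ (holds_imp _ _ _ (H2 q') Hq2) HS) as H3.
    apply (fun H' => holds_imp _ _ _ (holds_imp _ _ _ (H3 q') (sub_refl _ _) e) H').
    intros q''. imp_intro Hq''. apply (holds_imp _ _ _ (He q'')).
    eapply sub_trans; eauto. }
  induction A; intros p r w H1 H2; cbn [force] in *;
    try match goal with |- holds (cps _ _) _ => exact (HC _ _ _ H1 H2) end.
  1-3: apply (cps_N S); [apply ans_truth|exact H1|exact H2].
  - apply (Df_mem _ (inr (r n)) (inr (r n0))).
  - apply (Df_eq _ (inr (r n)) (inr (r n0))).
  - apply Df_bot.
  - split; [apply IHA1|apply IHA2]; auto; intros q; imp_intro Hq; imp_intro HS;
      apply (holds_imp _ _ _ (holds_imp _ _ _ (H2 q) Hq) HS).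
  - intros q. imp_intro Hq. imp_intro HA. apply IHA2. { eapply cps_sub; eauto. }
    intros q'. imp_intro Hq'. imp_intro HS.
    pose proof (holds_imp _ _ _ (holds_imp _ _ _ (H2 q') (sub_trans _ _ _ _ Hq Hq')) HS) as H3.
    apply (holds_imp _ _ _ (holds_imp _ _ _ (H3 q') (sub_refl _ _))).
    eapply force_sub; eauto.
  - intros x. apply IHA; auto. intros q. imp_intro Hq. imp_intro HS.
    apply (holds_imp _ _ _ (holds_imp _ _ _ (H2 q) Hq) HS).
  - intros x q. imp_intro Hq. imp_intro HA. apply IHA. { eapply cps_sub; eauto. }
    intros q'. imp_intro Hq'. imp_intro HS.
    pose proof (holds_imp _ _ _ (holds_imp _ _ _ (H2 q') (sub_trans _ _ _ _ Hq Hq')) HS) as H3.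
    apply (holds_imp _ _ _ (holds_imp _ _ _ (H3 x q') (sub_refl _ _))).
    eapply N_sub; eauto.
Qed.

Lemma N_of_extends q p Q w : holds (extends q p (fun _ => Q)) w ->
  holds (N q (fun _ => Q)) w.
Proof.
  intros H. apply (holds_ex _ d0). imp_intro Ht.
  apply (extends_forces q p (fun _ => Q) d0); auto.
Qed.

Lemma Df_sat_const A r : Delta0 A -> Df true (fun _ => sat A r).
Proof. intros H. apply (Df_sat true A (fun i => inr (r i))). auto. Qed.

Lemma Df_sat_scons A t r : Delta0 A -> Df true (fun v => sat A (ev t v .: r)).
Proof.
  intros H. eapply Df_ext; [|apply (Df_sat true A (t .: (fun i => inr (r i)))); auto].
  intros v w. replace (ev t v .: r) with (fun i => ev ((t .: (fun i => inr (r i))) i) v);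
    [easy|]. extensionality i; now destruct i.
Qed.

(** A condition extended by the truth value of a subformula forces that subformula, and [N_extends]
    discharges the extension. This treats antecedents and the continuations of disjunction and
    existence; [N_ball] makes the bounds uniform under bounded quantifiers. *)
Lemma force_Delta0 A : Delta0 A -> forall p r w,
  holds (force A p r) w <-> holds (N p (fun _ => sat A r)) w.
Proof.
  induction A as [i j|i j| |A IHA B IHB|A IHA B IHB|A IHA B IHB|A IHA|A IHA|s A IHA|s A IHA];
    cbn [force sat Delta0]; intros HD p r w; try easy.
  - destruct HD as [HA HB]. split; intros H.
    + apply (N_conj p (fun _ => sat A r) (fun _ => sat B r)); try apply mono_const;
        [apply IHA|apply IHB]; auto; apply H.
    + split; [apply IHA|apply IHB]; auto; revert H; apply N_map;
        intros z w' l [H1 H2]; auto.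
  - destruct HD as [HA HB]. split; intros H.
    + refine (cps_N _ _ _ _ _ H _).
      { apply ans_truth, Df_disj; apply Df_sat_const; auto. }
      intros q. imp_intro Hq. imp_intro HS. disj_destruct HS HS;
        [apply IHA in HS | apply IHB in HS]; auto;
        revert HS; apply N_map; intros z w' l HS'; [now apply disj_l|now apply disj_r].
    + intros q. imp_intro Hq. intros e. imp_intro He.
      (* The continuation is run at [q] extended by the truth of one disjunct; discharging it leaves
         an implication into the answer, which the true disjunction can use. *)
      assert_here H1 (N q (fun z => imp (sat A r) (E e z))).
      { apply (N_extends q (fun _ => sat A r)). { apply cond_truth, Df_sat_const; auto. }
        intros q'. imp_intro Hq'. apply (holds_imp _ _ _ (holds_imp _ _ _ (He q') (proj1 Hq'))).
        apply disj_l, IHA; auto. eapply N_of_extends; eauto. }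
      assert_here H2 (N q (fun z => imp (sat B r) (E e z))).
      { apply (N_extends q (fun _ => sat B r)). { apply cond_truth, Df_sat_const; auto. }
        intros q'. imp_intro Hq'. apply (holds_imp _ _ _ (holds_imp _ _ _ (He q') (proj1 Hq'))).
        apply disj_r, IHB; auto. eapply N_of_extends; eauto. }
      pose proof (N_sub _ _ _ _ Hq H) as H3.
      assert (HM : forall C, mono (fun z => imp (sat C r) (E e z))).
      { intros C. apply mono_imp; auto. intros ? ? ? _ Hx; exact Hx. }
      pose proof (N_conj _ _ _ _ (HM A) (HM B) H1 H2) as H4.
      pose proof (N_conj _ _ _ _ (mono_conj _ _ (HM A) (HM B)) (mono_const _) H4 H3) as H5.
      revert H5. apply N_map. intros z. imp_intro H5. destruct H5 as [[H5 H6] H7].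
      disj_destruct H7 H7; [apply (holds_imp _ _ _ H5 H7)|apply (holds_imp _ _ _ H6 H7)].
  - destruct HD as [HA HB]. split; intros H.
    + apply (N_extends p (fun _ => sat A r) (fun _ => sat B r)).
      { apply cond_truth, Df_sat_const; auto. }
      intros q. imp_intro Hq. apply IHB; auto.
      apply (holds_imp _ _ _ (holds_imp _ _ _ (H q) (proj1 Hq))).
      apply IHA; auto. eapply N_of_extends; eauto.
    + intros q. imp_intro Hq. imp_intro H1. apply IHB; auto. apply IHA in H1; auto.
      pose proof (N_sub _ _ _ _ Hq H) as H2.
      pose proof (N_conj _ _ _ _ (mono_const _) (mono_const _) H2 H1) as H3.
      revert H3. apply N_map. intros z. imp_intro H3. apply (holds_imp _ _ _ (proj1 H3)), H3.
  - split; intros H.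
    + apply (N_ball p (r s) (fun x _ => sat A (x .: r))).
      { apply (Df_sat_scons A (inl 0)). auto. }
      { intros x. apply mono_const. }
      intros x. imp_intro Hx. apply IHA; auto.
      apply (holds_imp _ _ _ (holds_imp _ _ _ (H x p) (sub_refl _ _))).
      apply (N_intro _ _ d0), Hx.
    + intros x q. imp_intro Hq. imp_intro H1. apply IHA; auto.
      pose proof (N_sub _ _ _ _ Hq H) as H2.
      pose proof (N_conj _ _ _ _ (mono_const _) (mono_const _) H2 H1) as H3.
      revert H3. apply N_map. intros z. imp_intro H3.
      apply (holds_imp _ _ _ (proj1 H3 x)), H3.
  - split; intros H.
    + refine (cps_N _ _ _ _ _ H _).
      { apply ans_truth. apply (Df_sat_const (BEx s A)). exact HD. }
      intros q. imp_intro Hq. imp_intro HS. ex_destruct HS x Hx.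
      destruct Hx as [Hx1 Hx2]. apply IHA in Hx2; auto.
      pose proof (N_conj _ _ _ _ (mono_const _) (mono_const _) Hx1 Hx2) as H3.
      revert H3. apply N_map. intros z. imp_intro H3. apply (holds_ex _ x). exact H3.
    + intros q. imp_intro Hq. intros e. imp_intro He.
      assert_here H1 (N q (fun z => ball (r s)
        (fun x => imp (sat A (x .: r)) (E e z)))).
      { apply (N_ball q (r s) (fun x z => imp (sat A (x .: r)) (E e z))).
        - apply Df_imp; [apply (Df_sat_scons A (inl 0)); auto|apply (Df_E' _ (inr e) (inl 1))].
        - intros x. apply mono_imp; auto. intros ? ? ? _ Hx; exact Hx.
        - intros x. imp_intro Hx.
          apply (N_extends q (fun _ => sat A (x .: r))).
          { apply cond_truth, Df_sat_const; auto. }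
          intros q'. imp_intro Hq'.
          apply (holds_imp _ _ _ (holds_imp _ _ _ (He q') (proj1 Hq'))).
          apply (holds_ex _ x). split; [apply (N_intro _ _ d0), Hx|].
          apply IHA; auto. eapply N_of_extends; eauto. }
      pose proof (N_sub _ _ _ _ Hq H) as H3.
      assert (HM : mono (fun z => ball (r s) (fun x => imp (sat A (x .: r)) (E e z)))).
      { apply (mono_ball _ (fun x z => imp (sat A (x .: r)) (E e z))).
        intros x. apply mono_imp; auto. intros ? ? ? _ Hx; exact Hx. }
      pose proof (N_conj _ _ _ _ HM (mono_const _) H1 H3) as H4.
      revert H4. apply N_map. intros z. imp_intro H4. destruct H4 as [H4 H5].
      ex_destruct H5 x Hx. destruct Hx as [Hx1 Hx2].
      apply (holds_imp _ _ _ (holds_imp _ _ _ (H4 x) Hx1) Hx2).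
Qed.

Lemma force_sat A p r w : Delta0 A -> holds (sat A r) w -> holds (force A p r) w.
Proof. intros HD H. apply force_Delta0; auto. apply (N_intro _ _ d0), H. Qed.

(** * Forced Sigma-formulas and Pi-formulas *)

Fixpoint subs (A : form) : list form :=
  A :: match A with
       | Mem _ _ | Eq _ _ | Bot => []
       | And A B | Or A B | Imp A B => subs A ++ subs B
       | All A | Ex A | BAll _ A | BEx _ A => subs A
       end.

Lemma subs_self A : In A (subs A).
Proof. destruct A; left; reflexivity. Qed.

(* The Pi half is exactly what makes the condition [A] force the antecedent [A] in
   the implication case of the Sigma half. *)
Lemma force_Sigma_Pi :
  (forall A, Sigma A -> incl (subs A) L -> forall p r w,
     holds (force A p r) w -> holds (N p (fun z => satz A z r)) w) /\
  (forall A, Pi A -> incl (subs A) L -> forall p r w,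
     holds (ex (fun z0 => all (fun z => imp (sub z0 z) (imp (T p z) (satz A z r))))) w ->
     holds (force A p r) w).
Proof.
  assert (HL : forall A B l, incl (A :: subs B ++ l) L -> incl (subs B) L).
  { intros A B l H x Hx. apply H. right. apply in_or_app; auto. }
  assert (HR : forall A B l, incl (A :: l ++ subs B) L -> incl (subs B) L).
  { intros A B l H x Hx. apply H. right. apply in_or_app; auto. }
  assert (HU : forall A B, incl (A :: subs B) L -> incl (subs B) L).
  { intros A B H x Hx. apply H. now right. }
  assert (HI : forall A l, incl (A :: l) L -> In A L).
  { intros A l H. apply H. now left. }
  apply Sigma_Pi_mutind; cbn [subs Neg].
  - intros A HD _ p r w H. apply force_Delta0 in H; auto.
    revert H. apply N_map. intros z w' l H. now rewrite satz_Delta0.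
  - intros A B HA IHA HB IHB HS p r w [H1 H2].
    apply (N_conj p (fun z => satz A z r) (fun z => satz B z r)); eauto;
      now apply satz_mono.
  - intros A B HA IHA HB IHB HS p r w H.
    refine (cps_N _ _ _ _ _ H _).
    { apply (ans_ex (Or A B)); eauto. now apply Sig_Or. }
    intros q. imp_intro Hq. imp_intro HC. disj_destruct HC HC;
      [apply IHA in HC | apply IHB in HC]; eauto; revert HC; apply N_map;
      intros z w' l HC'; [now apply disj_l|now apply disj_r].
  - intros s A HA IHA HS p r w H. cbn [satz].
    apply (N_ball p (r s) (fun x z => satz A z (x .: r))).
    { apply (Df_satz_scons true A (inl 1) (inl 0)). }
    { intros x. now apply satz_mono. }
    intros x. imp_intro Hx. apply IHA; eauto.
    apply (holds_imp _ _ _ (holds_imp _ _ _ (H x p) (sub_refl _ _))).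
    apply (N_intro _ _ d0), Hx.
  - intros s A HA IHA HS p r w H.
    refine (cps_N _ _ _ _ _ H _).
    { apply (ans_ex (BEx s A)); eauto. now apply Sig_BEx. }
    intros q. imp_intro Hq. imp_intro HC. ex_destruct HC x Hx. destruct Hx as [H1 H2].
    apply IHA in H2; eauto.
    assert_here H3 (N q (fun z => conj (mem x (r s)) (satz A z (x .: r)))).
    { apply (N_conj q (fun _ => mem x (r s)) (fun z => satz A z (x .: r))); auto;
        [apply mono_const|now apply satz_mono]. }
    revert H3. apply N_map. intros z. imp_intro H3. now apply (holds_ex _ x).
  - intros A HA IHA HS p r w H.
    refine (cps_N _ _ _ _ _ H _).
    { apply (ans_ex (Ex A)); eauto. now apply Sig_Ex. }
    intros q. imp_intro Hq. imp_intro HC. ex_destruct HC x Hx. apply IHA in Hx; eauto.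
    (* The relativised existential wants its witness inside the bound, so the bound is enlarged to
       contain [x] as well. *)
    ex_here (singleton_bound x) s Hs.
    assert_here H3 (N q (fun z => conj (mem x z) (satz A z (x .: r)))).
    { apply (N_conj q (fun z => mem x z) (fun z => satz A z (x .: r))); auto.
      - intros z z' w' Hz Hm. eapply sub_mem; eauto.
      - now apply satz_mono.
      - apply (N_intro _ _ s), Hs. }
    revert H3. apply N_map. intros z. imp_intro H3. now apply (holds_ex _ x).
  - intros A B HA IHA HB IHB HS p r w H. cbn [satz].
    apply (N_extends p (fun z => satz A z r) (fun z => satz B z r)).
    { apply (cond_ex A); eauto. apply (HL _ _ _ HS), subs_self. }
    intros q. imp_intro Hq. apply IHB; eauto.
    apply (holds_imp _ _ _ (holds_imp _ _ _ (H q) (proj1 Hq))).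
    (* The threshold [d0] is arbitrary: [T q z] contains the instance of [A] at every [z]. *)
    apply IHA; eauto. apply (holds_ex _ d0). intros z. imp_intro Hz. imp_intro Ht.
    pose proof (extends_forces _ _ _ _ _ Hq Ht) as HR'; exact HR'.
  - intros A HA IHA HS p r w H. cbn [satz].
    apply (N_extends p (fun z => satz A z r) (fun _ => bot)).
    { apply (cond_ex A); eauto. apply (HL _ _ _ HS), subs_self. }
    intros q. imp_intro Hq.
    apply (holds_imp _ _ _ (holds_imp _ _ _ (H q) (proj1 Hq))).
    apply IHA; eauto. apply (holds_ex _ d0). intros z. imp_intro Hz. imp_intro Ht.
    pose proof (extends_forces _ _ _ _ _ Hq Ht) as HR'; exact HR'.
  - intros A HD _ p r w H. apply force_Delta0; auto. ex_destruct H z Hz.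
    apply (holds_ex _ z). imp_intro Ht.
    rewrite <- (satz_Delta0 A HD z r).
    apply (holds_imp _ _ _ (holds_imp _ _ _ (Hz z) (sub_refl _ _)) Ht).
  - intros A B HA IHA HB IHB HS p r w H.
    split; [apply IHA|apply IHB]; eauto; ex_destruct H z0 Hz0; apply (holds_ex _ z0);
      intros z; imp_intro Hz; imp_intro Ht;
      apply (holds_imp _ _ _ (holds_imp _ _ _ (Hz0 z) Hz) Ht).
  - intros A B HA IHA HB IHB HS p r w H q. imp_intro Hq. intros e. imp_intro He.
    assert_here H1 (N q (fun z => imp (satz A z r) (E e z))).
    { apply (N_extends q (fun z => satz A z r)).
      { apply (cond_ex A); eauto. apply (HL _ _ _ HS), subs_self. }
      intros q'. imp_intro Hq'. apply (holds_imp _ _ _ (holds_imp _ _ _ (He q') (proj1 Hq'))).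
      apply disj_l, IHA; eauto. apply (holds_ex _ d0). intros z. imp_intro Hz. imp_intro Ht.
      pose proof (extends_forces _ _ _ _ _ Hq' Ht) as HR'; exact HR'. }
    assert_here H2 (N q (fun z => imp (satz B z r) (E e z))).
    { apply (N_extends q (fun z => satz B z r)).
      { apply (cond_ex B); eauto. apply (HR _ _ _ HS), subs_self. }
      intros q'. imp_intro Hq'. apply (holds_imp _ _ _ (holds_imp _ _ _ (He q') (proj1 Hq'))).
      apply disj_r, IHB; eauto. apply (holds_ex _ d0). intros z. imp_intro Hz. imp_intro Ht.
      pose proof (extends_forces _ _ _ _ _ Hq' Ht) as HR'; exact HR'. }
    (* At a bound [v] above all three the disjunction holds; its Pi disjunct descends to the bound
       of the matching implication, and the answer found there climbs back to [v]. *)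
    ex_destruct H z0 Hz0. ex_destruct H1 z1 Hz1. ex_destruct H2 z2 Hz2.
    ex_here (upper_bound2 z0 z1) u Hu. ex_here (upper_bound2 u z2) v Hv.
    destruct Hu as [Hu0 Hu1]. destruct Hv as [Hvu Hv2].
    pose proof (sub_trans _ _ _ _ Hu0 Hvu) as Hv0.
    pose proof (sub_trans _ _ _ _ Hu1 Hvu) as Hv1. apply (holds_ex _ v). imp_intro Ht.
    pose proof (holds_imp _ _ _ (holds_imp _ _ _ (Hz0 v) Hv0) (T_sub _ _ _ _ Hq Ht)) as Hd.
    disj_destruct Hd Hd.
    + apply (E_mono e z1); auto. apply (holds_imp (satz A z1 r)).
      * apply (holds_imp _ _ _ Hz1). eapply T_anti; eauto.
      * eapply (proj2 satz_mono A HA); eauto.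
    + apply (E_mono e z2); auto. apply (holds_imp (satz B z2 r)).
      * apply (holds_imp _ _ _ Hz2). eapply T_anti; eauto.
      * eapply (proj2 satz_mono B HB); eauto.
  - intros s A HA IHA HS p r w H x q. imp_intro Hq. imp_intro Hx.
    apply (force_N_elim _ _ _ _ _ Hx). imp_intro Hm. apply IHA; eauto.
    ex_destruct H z0 Hz0. apply (holds_ex _ z0). intros z. imp_intro Hz. imp_intro Ht.
    pose proof (holds_imp _ _ _ (holds_imp _ _ _ (Hz0 z) Hz) (T_sub _ _ _ _ Hq Ht)) as H1.
    apply (holds_imp _ _ _ (H1 x) Hm).
  - intros s A HA IHA HS p r w H q. imp_intro Hq. intros e. imp_intro He.
    assert (HM : forall x, mono (fun z => imp (satz A z (x .: r)) (E e z))).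
    { intros x. apply mono_imp; auto. now apply satz_mono. }
    assert_here H1 (N q (fun z => ball (r s)
      (fun x => imp (satz A z (x .: r)) (E e z)))).
    { apply (N_ball q (r s) (fun x z => imp (satz A z (x .: r)) (E e z))); auto.
      - apply Df_imp; [apply (Df_satz_scons true A (inl 1) (inl 0))
                      |apply (Df_E' _ (inr e) (inl 1))].
      - intros x. imp_intro Hx.
        apply (N_extends q (fun z => satz A z (x .: r))).
        { apply (cond_ex A); eauto. apply (HU _ _ HS), subs_self. }
        intros q'. imp_intro Hq'.
        apply (holds_imp _ _ _ (holds_imp _ _ _ (He q') (proj1 Hq'))).
        apply (holds_ex _ x). split; [apply (N_intro _ _ d0), Hx|].
        apply IHA; eauto. apply (holds_ex _ d0). intros z. imp_intro Hz. imp_intro Ht.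
        pose proof (extends_forces _ _ _ _ _ Hq' Ht) as HR'; exact HR'. }
    ex_destruct H z0 Hz0. ex_destruct H1 z1 Hz1.
    ex_here (upper_bound2 z0 z1) v Hv. destruct Hv as [Hv0 Hv1].
    apply (holds_ex _ v). imp_intro Ht.
    pose proof (holds_imp _ _ _ (holds_imp _ _ _ (Hz0 v) Hv0) (T_sub _ _ _ _ Hq Ht)) as Hd.
    ex_destruct Hd x Hx. destruct Hx as [Hx1 Hx2].
    apply (E_mono e z1); auto. apply (holds_imp (satz A z1 (x .: r))).
    + pose proof (holds_imp _ _ _ Hz1 (T_anti _ _ _ _ Hv1 Ht)) as H2.
      apply (holds_imp _ _ _ (H2 x) Hx1).
    + eapply (proj2 satz_mono A HA); eauto.
  - intros A HA IHA HS p r w H x. apply IHA; eauto.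
    (* This case is why the Pi half has a threshold: only bounds containing [x] allow the
       relativised quantifier to be instantiated at [x]. *)
    ex_destruct H z0 Hz0. ex_here (singleton_bound x) s Hs.
    ex_here (upper_bound2 z0 s) v Hv. destruct Hv as [Hv0 Hv1].
    apply (holds_ex _ v). intros z. imp_intro Hz. imp_intro Ht.
    pose proof (holds_imp _ _ _ (holds_imp _ _ _ (Hz0 z) (sub_trans _ _ _ _ Hv0 Hz)) Ht) as H1.
    apply (holds_imp _ _ _ (H1 x)). eauto using sub_mem.
  - intros A B HA IHA HB IHB HS p r w H q. imp_intro Hq. imp_intro H1. apply IHB; eauto.
    apply IHA in H1; eauto. ex_destruct H z0 Hz0. ex_destruct H1 z1 Hz1.
    ex_here (upper_bound2 z0 z1) v Hv. destruct Hv as [Hv0 Hv1].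
    apply (holds_ex _ v). intros z. imp_intro Hz. imp_intro Ht.
    pose proof (holds_imp _ _ _ (holds_imp _ _ _ (Hz0 z) (sub_trans _ _ _ _ Hv0 Hz))
      (T_sub _ _ _ _ Hq Ht)) as H1. apply (holds_imp _ _ _ H1).
    apply (proj1 satz_mono A HA r z1). { eapply sub_trans; eauto. }
    apply (holds_imp _ _ _ Hz1). eapply T_anti; [|exact Ht]. eapply sub_trans; eauto.
  - intros A HA IHA HS p r w H q. imp_intro Hq. imp_intro H1.
    apply IHA in H1; eauto. ex_destruct H z0 Hz0. ex_destruct H1 z1 Hz1.
    ex_here (upper_bound2 z0 z1) v Hv. destruct Hv as [Hv0 Hv1].
    apply (holds_ex _ v). imp_intro Ht.
    pose proof (holds_imp _ _ _ (holds_imp _ _ _ (Hz0 v) Hv0)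
      (T_sub _ _ _ _ Hq Ht)) as H1. apply (holds_imp _ _ _ H1).
    apply (proj1 satz_mono A HA r z1); auto.
    apply (holds_imp _ _ _ Hz1). eapply T_anti; [|exact Ht]. auto.
Qed.

(** * Equality under forcing, and soundness *)

Lemma N_eq p P Q w : holds (N p (fun _ => P)) w -> holds (N p (fun _ => Q)) w ->
  forall R, (forall w', holds P w' -> holds Q w' -> holds R w') -> holds (N p (fun _ => R)) w.
Proof.
  intros H1 H2 R H. pose proof (N_conj _ _ _ _ (mono_const _) (mono_const _) H1 H2) as H3.
  revert H3. apply N_map. intros z w' l [H3 H4]. auto.
Qed.

Definition eqs p (r r' : nat -> D) : Om := all (fun i => N p (fun _ => eq (r i) (r' i))).

Lemma eqs_sub p q r r' w : holds (sub p q) w -> holds (eqs p r r') w -> holds (eqs q r r') w.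
Proof. intros H1 H2 i. exact (N_sub _ _ _ _ H1 (H2 i)). Qed.

Lemma eqs_sym p r r' w : holds (eqs p r r') w -> holds (eqs p r' r) w.
Proof.
  intros H i. specialize (H i). revert H. apply N_map. intros z w' l. apply eq_sym.
Qed.

Lemma eqs_scons p r r' x w : holds (eqs p r r') w -> holds (eqs p (x .: r) (x .: r')) w.
Proof. intros H [|i]; [apply (N_intro _ _ d0), eq_r|apply H]. Qed.

Lemma cps_map S S' p w : holds (all (fun q => imp (sub p q) (imp (S q) (S' q)))) w ->
  holds (cps S p) w -> holds (cps S' p) w.
Proof.
  intros H HS q. imp_intro Hq. intros e. imp_intro He.
  apply (holds_imp _ _ _ (holds_imp _ _ _ (HS q) Hq e)).
  intros q'. imp_intro Hq'. imp_intro Hs.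
  apply (holds_imp _ _ _ (holds_imp _ _ _ (He q') Hq')).
  apply (holds_imp _ _ _ (holds_imp _ _ _ (H q') (sub_trans _ _ _ _ Hq Hq')) Hs).
Qed.

(** A forced equality is only locally true, so the substitution rule requires invariance under
    environments that agree locally at [p]. *)
Lemma force_eqs A : forall p r r' w, holds (eqs p r r') w ->
  holds (force A p r) w -> holds (force A p r') w.
Proof.
  induction A; intros p r r' w He H; cbn [force] in *.
  - refine (N_eq _ _ _ _ (He n) (N_eq _ _ _ _ (He n0) H
      (conj (eq (r n0) (r' n0)) (mem (r n) (r n0))) _) _ _).
    + intros; now split.
    + intros w' H1 [H2 H3]. eapply mem_eq; eauto.
  - refine (N_eq _ _ _ _ (He n) (N_eq _ _ _ _ (He n0) H
      (conj (eq (r n0) (r' n0)) (eq (r n) (r n0))) _) _ _).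
    + intros; now split.
    + intros w' H1 [H2 H3]. exact (eq_eq _ _ _ _ _ H1 H2 H3).
  - exact H.
  - destruct H. split; eauto.
  - revert H. apply cps_map. intros q. imp_intro Hq. imp_intro H.
    pose proof (eqs_sub _ _ _ _ _ Hq He) as He'.
    disj_destruct H H; [apply disj_l|apply disj_r]; eauto.
  - intros q. imp_intro Hq. imp_intro H1. pose proof (eqs_sub _ _ _ _ _ Hq He) as He'.
    apply (IHA2 _ r); auto. apply (holds_imp _ _ _ (holds_imp _ _ _ (H q) Hq)).
    apply (IHA1 _ r'); auto. now apply eqs_sym.
  - intros x. apply (IHA p (x .: r)); [now apply eqs_scons|apply H].
  - revert H. apply cps_map. intros q. imp_intro Hq. imp_intro H.
    pose proof (eqs_sub _ _ _ _ _ Hq He) as He'.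
    ex_destruct H x Hx. apply (holds_ex _ x). eapply IHA; [|exact Hx]. now apply eqs_scons.
  - intros x q. imp_intro Hq. imp_intro H1. pose proof (eqs_sub _ _ _ _ _ Hq He) as He'.
    apply (IHA _ (x .: r)); [now apply eqs_scons|].
    apply (holds_imp _ _ _ (holds_imp _ _ _ (H x q) Hq)).
    refine (N_eq _ _ _ _ (He' n) H1 _ _). intros w' H2 H3.
    eapply mem_eq; [apply eq_r|apply eq_sym; exact H2|exact H3].
  - revert H. apply cps_map. intros q. imp_intro Hq. imp_intro H.
    pose proof (eqs_sub _ _ _ _ _ Hq He) as He'.
    ex_destruct H x Hx. destruct Hx as [Hx1 Hx2]. apply (holds_ex _ x). split.
    + refine (N_eq _ _ _ _ (He' n) Hx1 _ _). intros w' H2 H3.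
      eapply mem_eq; [apply eq_r|exact H2|exact H3].
    + eapply IHA; [|exact Hx2]. now apply eqs_scons.
Qed.

(** Disjunction and existence are eliminated by [cps_elim], falsity by [force_N_elim]. The context
    is packed into one truth value so that it travels to later worlds with the other hypotheses. *)
Lemma force_sound Ax G A : ND Ax G A ->
  (forall B, Ax B -> forall p r w, holds (force B p r) w) ->
  forall p r w, holds (all (fun B => all (fun _ : In B G => force B p r))) w ->
  holds (force A p r) w.
Proof.
  intros HND HAx.
  assert (HG : forall A G p r w, holds (force A p r) w ->
    holds (all (fun B => all (fun _ : In B G => force B p r))) w ->
    holds (all (fun B => all (fun _ : In B (A :: G) => force B p r))) w).
  { intros A0 G0 p r w H1 H2 B [<-|HB]; [exact H1|now apply H2]. }
  assert (HS : forall G p q r w, holds (sub p q) w ->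
    holds (all (fun B => all (fun _ : In B G => force B p r))) w ->
    holds (all (fun B => all (fun _ : In B G => force B q r))) w).
  { intros G0 p q r w H1 H2 B HB. eapply force_sub; eauto. now apply H2. }
  assert (Hlift : forall G p x r w,
    holds (all (fun B => all (fun _ : In B G => force B p r))) w ->
    holds (all (fun B => all (fun _ : In B (map lift G) => force B p (x .: r)))) w).
  { intros G0 p x r w H B HB. apply in_map_iff in HB as (B' & <- & HB).
    unfold lift. rewrite force_rename. exact (H B' HB). }
  induction HND; intros p r w HG0.
  - now apply HG0.
  - now apply HAx.
  - apply (force_N_elim _ _ _ _ _ (IHHND p r w HG0)). imp_intro H. now apply bot_elim.
  - split; auto.
  - apply (IHHND p r w HG0).
  - apply (IHHND p r w HG0).
  - apply cps_intro. intros q w' l Hq. apply disj_l. eapply force_sub; eauto.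
    eapply holds_mono; eauto.
  - apply cps_intro. intros q w' l Hq. apply disj_r. eapply force_sub; eauto.
    eapply holds_mono; eauto.
  - eapply cps_elim. { exact (IHHND1 p r w HG0). }
    intros q. imp_intro Hq. imp_intro H. pose proof (HS _ _ _ _ _ Hq HG0) as HG1.
    disj_destruct H H; [apply IHHND2|apply IHHND3]; apply HG; auto.
  - intros q. imp_intro Hq. imp_intro H. apply IHHND. apply HG; auto. eapply HS; eauto.
  - apply (holds_imp _ _ _ (holds_imp _ _ _ (IHHND1 p r w HG0 p) (sub_refl _ _))). auto.
  - intros x. apply IHHND. auto.
  - unfold subst0. rewrite force_rename, inst_scons. apply (IHHND p r w HG0).
  - apply cps_intro. intros q w' l Hq. apply (holds_ex _ (r x)).
    specialize (IHHND p r w HG0). unfold subst0 in IHHND.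
    rewrite force_rename, inst_scons in IHHND. eapply force_sub; eauto.
    eapply holds_mono; eauto.
  - eapply cps_elim. { exact (IHHND1 p r w HG0). }
    intros q. imp_intro Hq. imp_intro H. pose proof (HS _ _ _ _ _ Hq HG0) as HG1.
    ex_destruct H x Hx.
    assert_here H1 (force (lift B) q (x .: r)).
    { apply IHHND2. apply HG; auto. }
    unfold lift in H1. rewrite force_rename in H1. exact H1.
  - apply (N_intro _ _ d0), eq_r.
  - specialize (IHHND1 p r w HG0). specialize (IHHND2 p r w HG0).
    unfold subst0 in *. rewrite force_rename, inst_scons in *.
    eapply force_eqs; [|exact IHHND2]. intros [|i]; [exact IHHND1|].
    apply (N_intro _ _ d0), eq_r.
Qed.

(** * Definability of the forcing relation *)

Lemma Df_sub b s t : Df b (fun v => sub (ev s v) (ev t v)).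
Proof.
  apply (Df_ball b (fun x v => mem x (ev t v)) s).
  destruct t as [j|d]; [apply (Df_mem b (inl 0) (inl (S j)))|apply (Df_mem b (inl 0) (inr d))].
Qed.

Lemma Df_N P : Df false P -> Df false (fun v => N (v 0) (fun _ => P v)).
Proof.
  intros H. apply (Df_ex (fun z v => imp (T (v 0) z) (P v))). apply Df_imp.
  - apply (Df_T' _ (inl 1) (inl 0)).
  - apply (Df_subst _ P (fun i => inl (S i)) H).
Qed.

Lemma Df_N_ans : Df false (fun v => N (v 0) (E (v 1))).
Proof.
  apply (Df_ex (fun z v => imp (T (v 0) z) (E (v 1) z))). apply Df_imp.
  - apply (Df_T' _ (inl 1) (inl 0)).
  - apply (Df_E' _ (inl 2) (inl 0)).
Qed.

Lemma Df_cps (S : D -> (nat -> D) -> Om) : Df false (fun v => S (v 0) (fun i => v (1 + i))) ->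
  Df false (fun v => cps (fun q => S q (fun i => v (1 + i))) (v 0)).
Proof.
  intros H.
  apply (Df_all (fun q v => imp (sub (v 0) q) (all (fun e =>
    imp (all (fun r => imp (sub q r) (imp (S r (fun i => v (1 + i))) (N r (E e)))))
        (N q (E e)))))).
  apply Df_imp; [apply (Df_sub _ (inl 1) (inl 0))|].
  apply (Df_all (fun e v =>
    imp (all (fun r => imp (sub (v 0) r) (imp (S r (fun i => v (2 + i))) (N r (E e)))))
        (N (v 0) (E e)))).
  apply Df_imp.
  - apply (Df_all (fun r v =>
      imp (sub (v 1) r) (imp (S r (fun i => v (3 + i))) (N r (E (v 0)))))).
    apply Df_imp; [apply (Df_sub _ (inl 2) (inl 0))|]. apply Df_imp.
    + apply (Df_subst _ _ (inl 0 .: (fun i => inl (4 + i))) H).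
    + apply (Df_subst _ _ (inl 0 .: (fun i => inl (1 + i))) Df_N_ans).
  - apply (Df_subst _ _ (inl 1 .: (fun _ => inl 0)) Df_N_ans).
Qed.

Lemma Df_at (F : D -> (nat -> D) -> Om) t g :
  Df false (fun v => F (v 0) (fun i => v (1 + i))) ->
  Df false (fun v => F (ev t v) (fun i => ev (g i) v)).
Proof. intros H. apply (Df_subst false _ (t .: g) H). Qed.

Lemma Df_at_scons (F : D -> (nat -> D) -> Om) t s g :
  Df false (fun v => F (v 0) (fun i => v (1 + i))) ->
  Df false (fun v => F (ev t v) (ev s v .: (fun i => ev (g i) v))).
Proof.
  intros H. eapply Df_ext; [|apply (Df_at F t (s .: g) H)]. intros v w.
  replace (ev s v .: (fun i => ev (g i) v)) with (fun i => ev ((s .: g) i) v); [easy|].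
  extensionality i. now destruct i.
Qed.

(** Makes Set Induction of the model applicable to statements about forcing; the condition is entry
    0 and the environment follows it. *)
Lemma Df_force A : Df false (fun v => force A (v 0) (fun i => v (1 + i))).
Proof.
  induction A as [i j|i j| |A IHA B IHB|A IHA B IHB|A IHA B IHB|A IHA|A IHA|s A IHA|s A IHA];
    cbn [force].
  - apply (Df_N (fun v => mem (v (1 + i)) (v (1 + j)))).
    apply (Df_mem _ (inl (1 + i)) (inl (1 + j))).
  - apply (Df_N (fun v => eq (v (1 + i)) (v (1 + j)))).
    apply (Df_eq _ (inl (1 + i)) (inl (1 + j))).
  - apply (Df_N (fun v => bot)), Df_bot.
  - now apply Df_conj.
  - apply (Df_cps (fun q r => disj (force A q r) (force B q r))). now apply Df_disj.
  - apply (Df_all (fun q v => imp (sub (v 0) q)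
      (imp (force A q (fun i => v (1 + i))) (force B q (fun i => v (1 + i)))))).
    apply Df_imp; [apply (Df_sub _ (inl 1) (inl 0))|].
    apply Df_imp; [apply (Df_at _ (inl 0) (fun i => inl (2 + i)) IHA)
                  |apply (Df_at _ (inl 0) (fun i => inl (2 + i)) IHB)].
  - apply (Df_all (fun x v => force A (v 0) (x .: (fun i => v (1 + i))))).
    apply (Df_at_scons _ (inl 1) (inl 0) (fun i => inl (2 + i)) IHA).
  - apply (Df_cps (fun q r => ex (fun x => force A q (x .: r)))).
    apply (Df_ex (fun x v => force A (v 0) (x .: (fun i => v (1 + i))))).
    apply (Df_at_scons _ (inl 1) (inl 0) (fun i => inl (2 + i)) IHA).
  - apply (Df_all (fun x v => all (fun q => imp (sub (v 0) q)
      (imp (N q (fun _ => mem x (v (1 + s)))) (force A q (x .: (fun i => v (1 + i)))))))).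
    apply (Df_all (fun q v => imp (sub (v 1) q)
      (imp (N q (fun _ => mem (v 0) (v (2 + s))))
           (force A q (v 0 .: (fun i => v (2 + i))))))).
    apply Df_imp; [apply (Df_sub _ (inl 2) (inl 0))|]. apply Df_imp.
    + apply (Df_N (fun v => mem (v 1) (v (3 + s)))).
      apply (Df_mem _ (inl 1) (inl (3 + s))).
    + apply (Df_at_scons _ (inl 0) (inl 1) (fun i => inl (3 + i)) IHA).
  - apply (Df_cps (fun q r => ex (fun x =>
      conj (N q (fun _ => mem x (r s))) (force A q (x .: r))))).
    apply (Df_ex (fun x v => conj (N (v 0) (fun _ => mem x (v (1 + s))))
      (force A (v 0) (x .: (fun i => v (1 + i)))))).
    apply Df_conj.
    + apply (Df_subst _ (fun v => N (v 0) (fun _ => mem (v 1) (v (2 + s))))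
        (inl 1 .: inl 0 .: (fun i => inl (2 + i)))).
      apply (Df_N (fun v => mem (v 1) (v (2 + s)))).
      apply (Df_mem _ (inl 1) (inl (2 + s))).
    + apply (Df_at_scons _ (inl 1) (inl 0) (fun i => inl (2 + i)) IHA).
Qed.

(** * Forcing the axioms of [IKP] and Sigma-Reflection *)

Lemma force_ex A p x r w : holds (force A p (x .: r)) w -> holds (force (Ex A) p r) w.
Proof.
  intros H. apply cps_intro. intros q w' l Hq. apply (holds_ex _ x).
  eapply force_sub; [exact Hq|]. eapply holds_mono; eauto.
Qed.

(** Pair, Union, Infinity and Separation take their witnesses from the model, after which a true
    Delta0 matrix is forced. Extensionality combines two local inclusions, and Set Induction is
    applied to forcing itself. *)
Lemma force_IKP C : IKP C -> incl (subs C) L -> forall p r w, holds (force C p r) w.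
Proof.
  intros HC HL p r w. destruct HC as [| | | |A HA|A HA|A].
  - intros x y q. imp_intro Hq. imp_intro H.
    refine (N_eq q (sub x y) (sub y x) _ _ _ _ _).
    + apply (N_ball q x (fun z _ => mem z y)); [|intros; apply mono_const|].
      * apply (Df_mem _ (inl 0) (inr y)).
      * intros z. imp_intro Hz. pose proof (holds_imp _ _ _ (proj1 (H z) q) (sub_refl _ _)) as H1.
        apply (holds_imp _ _ _ H1). apply (N_intro _ _ d0), Hz.
    + apply (N_ball q y (fun z _ => mem z x)); [|intros; apply mono_const|].
      * apply (Df_mem _ (inl 0) (inr x)).
      * intros z. imp_intro Hz. pose proof (holds_imp _ _ _ (proj2 (H z) q) (sub_refl _ _)) as H1.
        apply (holds_imp _ _ _ H1). apply (N_intro _ _ d0), Hz.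
    + intros w' H1 H2. apply (holds_imp _ _ _ (ax _ ikp_ext r w' x y)).
      intros z. split; [apply (H1 z)|apply (H2 z)].
  - intros a b. ex_destruct (ax _ ikp_pair r w a b) c Hc.
    apply (force_ex _ _ c), force_sat; [cbn; auto|exact Hc].
  - intros a. ex_destruct (ax _ ikp_union r w a) c Hc.
    apply (force_ex _ _ c), force_sat; [cbn; auto|exact Hc].
  - ex_destruct (ax _ ikp_inf r w) a Ha. destruct Ha as [Ha1 Ha2].
    apply (force_ex _ _ a). split.
    + ex_destruct Ha1 y Hy. apply (force_ex _ _ y), force_sat; [cbn; auto|exact Hy].
    + apply force_sat; [cbn; auto|exact Ha2].
  - intros a. ex_destruct (ax _ (ikp_sep A HA) r w a) b Hb.
    apply (force_ex _ _ b). intros x. apply (force_sat (Iff _ _)); [|exact (Hb x)].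
    pose proof (Delta0_rename A (shift_from 1 2) HA). cbn; auto.
  - intros a q. imp_intro Hq. imp_intro H.
    (* The premise of Collection is Sigma, so it yields a bound [z] inside which all witnesses lie
       locally; [z] itself is the collecting set. *)
    apply force_Sigma_Pi in H.
    2: { apply Sig_BAll, Sig_Ex, Sig_D0, Delta0_rename, HA. }
    2: { intros B HB. apply HL. right. right. apply in_or_app. now left. }
    ex_destruct H z Hz. apply (force_ex _ _ z), force_Delta0.
    { cbn. now apply Delta0_rename. }
    apply (holds_ex _ z). imp_intro Ht.
    pose proof (holds_imp _ _ _ Hz Ht) as H1. intros x. imp_intro Hx.
    pose proof (holds_imp _ _ _ (H1 x) Hx) as H2. ex_destruct H2 y Hy.
    destruct Hy as [Hy1 Hy2]. apply (holds_ex _ y). split; [exact Hy1|].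
    rewrite satz_Delta0 in Hy2 by now apply Delta0_rename.
    rewrite sat_rename in *.
    match goal with H : holds (sat _ ?f) _ |- holds (sat _ ?g) _ => replace g with f end;
      [exact Hy2|].
    extensionality i. unfold shift_from. destruct i as [|[|i]]; cbn; try easy.
    now rewrite !(Nat.add_comm i).
  - intros q. imp_intro Hq. imp_intro H.
    apply (induction (fun x => force A q (x .: r))).
    { apply (Df_at_scons _ (inr q) (inl 0) (fun i => inr (r i)) (Df_force A)). }
    intros x. imp_intro Hx.
    apply (holds_imp _ _ _ (holds_imp _ _ _ (H x q) (sub_refl _ _))).
    (* The membership of [y] in [x] is known only locally; made true, it gives access to the
       induction hypothesis of the model. *)
    intros y q'. imp_intro Hq'. imp_intro Hy. apply (force_N_elim _ _ _ _ _ Hy). imp_intro Hm.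
    rewrite force_rename.
    replace (fun n => (y .: x .: r) (shift_from 1 1 n)) with (y .: r).
    { eapply force_sub; [exact Hq'|]. apply (holds_imp _ _ _ (Hx y) Hm). }
    extensionality i. unfold shift_from. destruct i; cbn; [easy|].
    now rewrite Nat.add_comm.
Qed.

(** The bound that a forced Sigma-formula supplies is the witness; relativised to it the formula is
    Delta0, so its local truth is again forcing. *)
Lemma force_SigmaRefl A : Sigma A -> incl (subs A) L -> forall p r w,
  holds (force (Imp A (Ex (rel (lift A) 0))) p r) w.
Proof.
  intros HA HL p r w q. imp_intro Hq. imp_intro H. apply force_Sigma_Pi in H; auto.
  ex_destruct H z Hz. apply (force_ex _ _ z), force_Delta0; [apply Delta0_rel|].
  unfold lift. rewrite sat_rel. apply (holds_ex _ z), Hz.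
Qed.

(** Soundness makes every condition force [A]. At the condition from [top_ex] the hypothesis [T p z]
    is always true, so local truth there is just the existence of a bound. *)
Lemma force_conservation Ax A : ND Ax [] (unfold A) ->
  (forall B, Ax B -> exists C, IKP_SigmaRefl C /\ incl (subs C) L /\ B = unfold C) ->
  Sigma A -> incl (subs A) L -> forall r w, holds (ex (fun z => satz A z r)) w.
Proof.
  intros HND HAx HA HL r w. ex_here top_ex p Hp.
  assert_here H (N p (fun z => satz A z r)).
  { apply force_Sigma_Pi; auto. rewrite <- force_unfold.
    apply (force_sound _ _ _ HND); [|intros B []].
    intros B HB p' r' w'. destruct (HAx B HB) as (C & [HC|(C' & HC & ->)] & HCL & ->);
      rewrite force_unfold.
    - now apply force_IKP.
    - apply force_SigmaRefl; [exact HC|]. intros B HB'. apply HCL. right.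
      apply in_or_app. now left. }
  ex_destruct H z Hz. apply (holds_ex _ z), (holds_imp _ _ _ Hz (Hp z)).
Qed.

End Forcing.

(** * Coding instances of formulas by sets *)

(** A Delta0 description weaker than being the Kuratowski pair: for a pair with equal entries it
    leaves [y] free. Requiring [in_union y c] as well repairs this. *)
Definition pair_of (c x y : D) : Om :=
  conj (ball c (fun u => mem x u)) (ball c (fun u => ball u (fun v => disj (eq v x) (eq v y)))).

Definition in_union (x c : D) : Om := bex c (fun u => mem x u).

(** The code is the Kuratowski pair. Uniqueness avoids deciding whether [a] equals [b]: [x] lies in
    [{a}]; [y] equals [a] or [b]; and in the former case [b], being [x] or [y], equals both. *)
Lemma pair_ex a b w : holds (ex (fun c => conj (conj (in_union a c) (in_union b c))
  (conj (pair_of c a b) (all (fun x => all (fun y => imp (in_union y c)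
    (imp (pair_of c x y) (conj (eq x a) (eq y b))))))))) w.
Proof.
  ex_here (pairing a a) s Hs. ex_here (pairing a b) t Ht. ex_here (pairing s t) c Hc.
  assert_here Hsc (mem s c).
  { apply (holds_imp _ _ _ (proj2 (Hc s))), disj_l, eq_r. }
  assert_here Htc (mem t c).
  { apply (holds_imp _ _ _ (proj2 (Hc t))), disj_r, eq_r. }
  assert_here Hbt (mem b t).
  { apply (holds_imp _ _ _ (proj2 (Ht b))), disj_r, eq_r. }
  assert_here Hat (mem a t).
  { apply (holds_imp _ _ _ (proj2 (Ht a))), disj_l, eq_r. }
  assert_here Has (mem a s).
  { apply (holds_imp _ _ _ (proj2 (Hs a))), disj_l, eq_r. }
  assert_here Hu (ball c (fun u => ball u (fun v => disj (eq v a) (eq v b)))).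
  { intros u. imp_intro Hu. intros v. imp_intro Hv.
    disj_destruct (holds_imp _ _ _ (proj1 (Hc u)) Hu) Huv.
    - pose proof (mem_eq _ _ _ _ _ (eq_r v _) Huv Hv) as Hv'.
      disj_destruct (holds_imp _ _ _ (proj1 (Hs v)) Hv') Hva; now apply disj_l.
    - pose proof (mem_eq _ _ _ _ _ (eq_r v _) Huv Hv) as Hv'.
      apply (holds_imp _ _ _ (proj1 (Ht v)) Hv'). }
  apply (holds_ex _ c). split; [split|split].
  - apply (holds_ex _ s). now split.
  - apply (holds_ex _ t). now split.
  - split; [|exact Hu]. intros u. imp_intro Huc.
    disj_destruct (holds_imp _ _ _ (proj1 (Hc u)) Huc) Huv;
      (eapply mem_eq; [apply eq_r|apply eq_sym; exact Huv|]); assumption.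
  - intros x y. imp_intro Hy. imp_intro Hp. destruct Hp as [Hp1 Hp2].
    pose proof (holds_imp _ _ _ (proj1 (Hs x)) (holds_imp _ _ _ (Hp1 s) Hsc)) as Hx.
    assert_here Hxa (eq x a). { disj_destruct Hx Hx; exact Hx. }
    split; [exact Hxa|]. ex_destruct Hy u Hyu. destruct Hyu as [Huc Hyu].
    pose proof (holds_imp _ _ _ (Hu u) Huc) as Huu.
    disj_destruct (holds_imp _ _ _ (Huu y) Hyu) Hyab; [|exact Hyab].
    pose proof (holds_imp _ _ _ (Hp2 t) Htc) as Htt.
    disj_destruct (holds_imp _ _ _ (Htt b) Hbt) Hb.
    + apply (eq_eq a y x b); [now apply eq_sym|now apply eq_sym|now apply eq_sym].
    + now apply eq_sym.
Qed.

Definition upd (k : nat) (x : D) (r : nat -> D) (i : nat) : D := if i =? k then x else r i.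

(* [c] codes a tuple that satisfies [R] once stored in the first [k] entries of [r]. *)
Fixpoint decode (k : nat) (R : (nat -> D) -> Om) (c : D) (r : nat -> D) : Om :=
  match k with
  | 0 => R r
  | S k => bex c (fun u => bex u (fun x => bex c (fun u' => bex u' (fun y =>
             conj (pair_of c x y) (decode k R y (upd k x r))))))
  end.

Lemma decode_map k R R' : forall c r w, holds (all (fun r => imp (R r) (R' r))) w ->
  holds (decode k R c r) w -> holds (decode k R' c r) w.
Proof.
  induction k as [|k IH]; intros c r w HR H; cbn [decode] in *.
  - apply (holds_imp _ _ _ (HR r) H).
  - ex_destruct H u Hu. destruct Hu as [Hu H]. apply (holds_ex _ u). split; [exact Hu|].
    ex_destruct H x Hx. destruct Hx as [Hx H]. apply (holds_ex _ x). split; [exact Hx|].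
    ex_destruct H u' Hu'. destruct Hu' as [Hu' H]. apply (holds_ex _ u'). split; [exact Hu'|].
    ex_destruct H y Hy. destruct Hy as [Hy H]. apply (holds_ex _ y). split; [exact Hy|].
    destruct H as [H1 H2]. split; [exact H1|]. now apply IH.
Qed.

Lemma Df_pair_of b s t u : Df b (fun v => pair_of (v s) (v t) (v u)).
Proof.
  apply Df_conj.
  - apply (Df_ball b (fun x v => mem (v t) x) (inl s)). apply (Df_mem b (inl (S t)) (inl 0)).
  - apply (Df_ball b (fun x v => ball x (fun x' => disj (eq x' (v t)) (eq x' (v u)))) (inl s)).
    apply (Df_ball b (fun x' v => disj (eq x' (v (S t))) (eq x' (v (S u)))) (inl 0)).
    apply Df_disj; [apply (Df_eq b (inl 0) (inl (S (S t))))
                   |apply (Df_eq b (inl 0) (inl (S (S u))))].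
Qed.

Lemma Df_decode k (R : D -> (nat -> D) -> Om) :
  Df true (fun v => R (v 0) (fun i => v (1 + i))) ->
  Df true (fun v => decode k (R (v 0)) (v 1) (fun i => v (2 + i))).
Proof.
  intros HR. induction k as [|k IH].
  - apply (Df_subst _ _ (inl 0 .: (fun i => inl (2 + i))) HR).
  - apply (Df_bex true (fun u v => bex u (fun x => bex (v 1) (fun u' => bex u' (fun y =>
      conj (pair_of (v 1) x y)
        (decode k (R (v 0)) y (upd k x (fun i => v (2 + i))))))) ) (inl 1)).
    apply (Df_bex true (fun x v => bex (v 2) (fun u' => bex u' (fun y =>
      conj (pair_of (v 2) x y)
        (decode k (R (v 1)) y (upd k x (fun i => v (3 + i))))))) (inl 0)).
    apply (Df_bex true (fun u' v => bex u' (fun y =>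
      conj (pair_of (v 3) (v 0) y)
        (decode k (R (v 2)) y (upd k (v 0) (fun i => v (4 + i)))))) (inl 3)).
    apply (Df_bex true (fun y v =>
      conj (pair_of (v 4) (v 1) y)
        (decode k (R (v 3)) y (upd k (v 1) (fun i => v (5 + i))))) (inl 0)).
    apply Df_conj; [apply (Df_pair_of true 5 2 0)|].
    eapply Df_ext; [|apply (Df_subst _ _
      (inl 4 .: inl 0 .: (fun i => if i =? k then inl 2 else inl (6 + i))) IH)].
    intros v w. cbn [scons ev plus].
    match goal with |- holds (decode _ _ _ ?f) _ <-> holds (decode _ _ _ ?g) _ =>
      replace g with f; [easy|] end.
    extensionality i. unfold upd. now destruct (i =? k).
Qed.

(** The codes are nested pairs, entry [k] being paired with a code of the entries before it. The
    code is chosen before [z], so that one code serves all bounds. *)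
Lemma code_ex k (R : D -> (nat -> D) -> Om) a :
  Df true (fun v => R (v 0) (fun i => v (1 + i))) -> forall r w,
  holds (ex (fun c => all (fun z => iff (decode k (R z) c r)
    (R z (fun i => if i <? k then a i else r i))))) w.
Proof.
  intros HR. induction k as [|k IH]; intros r w.
  - apply (holds_ex _ d0). intros z. cbn [decode].
    replace (fun i => if i <? 0 then a i else r i) with r by now extensionality i.
    split; imp_intro H; exact H.
  - ex_here (IH (upd k (a k) r)) c' Hc'. ex_here (pair_ex (a k) c') c Hc.
    destruct Hc as [[Hc1 Hc2] [Hc3 Hc4]]. apply (holds_ex _ c). intros z.
    specialize (Hc' z). cbn [decode].
    replace (fun i => if i <? k then a i else upd k (a k) r i)
      with (fun i => if i <? S k then a i else r i) in Hc'.
    2: { extensionality i. unfold upd.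
      destruct (Nat.ltb_spec i (S k)), (Nat.ltb_spec i k), (Nat.eqb_spec i k);
        subst; try easy; lia. }
    split; imp_intro H.
    + apply (holds_imp _ _ _ (proj1 Hc')). ex_destruct H u Hu. destruct Hu as [Hu H].
      ex_destruct H x Hx. destruct Hx as [Hx H].
      ex_destruct H u' Hu'. destruct Hu' as [Hu' H].
      ex_destruct H y Hy. destruct Hy as [Hy H]. destruct H as [Hp H].
      assert_here Hyc (in_union y c). { apply (holds_ex _ u'). now split. }
      pose proof (holds_imp _ _ _ (holds_imp _ _ _ (Hc4 x y) Hyc) Hp) as [He1 He2].
      (* The decoded components agree with [a k] and [c'] only up to [eq], which the definable
         predicate respects. *)
      apply (Df_resp true _ (z .: y .: upd k x r) (z .: c' .: upd k (a k) r) _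
        (Df_decode k R HR)); [|exact H].
      intros [|[|i]]; cbn [scons]; [apply eq_r|exact He2|].
      unfold upd. destruct (i =? k); [exact He1|apply eq_r].
    + apply (holds_imp _ _ _ (proj2 Hc')) in H.
      ex_destruct Hc1 u Hu. destruct Hu as [Hu1 Hu2].
      ex_destruct Hc2 u' Hu'. destruct Hu' as [Hu1' Hu2'].
      apply (holds_ex _ u). split; [exact Hu1|]. apply (holds_ex _ (a k)). split; [exact Hu2|].
      apply (holds_ex _ u'). split; [exact Hu1'|]. apply (holds_ex _ c'). split; [exact Hu2'|].
      now split.
Qed.

(** * Selecting one formula out of a finite list *)

Definition inh (x : D) : Om := sat (BEx 0 (Eq 0 0)) (fun _ => x).

(* Variable [M + i] switches the [i]-th formula on when it is inhabited. *)
Fixpoint switch_conj (M : nat) (l : list form) : form :=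
  match l with
  | [] => Eq 0 0
  | A :: l => And (Imp (BEx M (Eq 0 0)) A) (switch_conj (S M) l)
  end.

Fixpoint switch_disj (M : nat) (l : list form) : form :=
  match l with
  | [] => Bot
  | A :: l => Or (And (BEx M (Eq 0 0)) A) (switch_disj (S M) l)
  end.

Lemma switch_conj_Pi l : forall M, (forall A, In A l -> Pi A) -> Pi (switch_conj M l).
Proof.
  induction l as [|A l IH]; intros M H; cbn; [now apply Pi_D0|].
  apply Pi_And; [apply Pi_Imp; [now apply Sig_D0|]|apply IH]; auto with datatypes.
Qed.

Lemma switch_disj_Sigma l : forall M, (forall A, In A l -> Sigma A) -> Sigma (switch_disj M l).
Proof.
  induction l as [|A l IH]; intros M H; cbn; [now apply Sig_D0|].
  apply Sig_Or; [apply Sig_And; [now apply Sig_D0|]|apply IH]; auto with datatypes.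
Qed.

(** A conjunct that is switched off holds vacuously. So one formula represents the whole list, and
    the choice among its members is stored in ordinary entries of a code. *)
Lemma switch_conj_spec l : forall M i A z r w, nth_error l i = Some A ->
  holds (inh (r (M + i))) w ->
  (forall j, j < length l -> j <> i -> holds (imp (inh (r (M + j))) bot) w) ->
  holds (iff (satz (switch_conj M l) z r) (satz A z r)) w.
Proof.
  assert (Hoff : forall l M z r w,
    (forall j, j < length l -> holds (imp (inh (r (M + j))) bot) w) ->
    holds (satz (switch_conj M l) z r) w).
  { clear l. induction l as [|A l IH]; intros M z r w H;
      cbn [switch_conj satz]; [apply eq_r|]. split.
    - specialize (H 0 ltac:(cbn; lia)). rewrite Nat.add_0_r in H. imp_intro H1.
      apply bot_elim, (holds_imp _ _ _ H), H1.
    - apply IH. intros j Hj. specialize (H (S j) ltac:(cbn; lia)).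
      now rewrite Nat.add_succ_r in H. }
  induction l as [|B l IH]; intros M i A z r w HA Hon H; [now destruct i|].
  destruct i as [|i]; cbn [nth_error switch_conj satz] in *.
  - injection HA as ->. rewrite Nat.add_0_r in Hon.
    assert (H1 : holds (satz (switch_conj (S M) l) z r) w).
    { apply Hoff. intros j Hj. specialize (H (S j) ltac:(cbn; lia) ltac:(lia)).
      now rewrite Nat.add_succ_r in H. }
    clear H. split; imp_intro H.
    + apply (holds_imp _ _ _ (proj1 H)), Hon.
    + split; [|exact H1]. imp_intro H2. exact H.
  - assert (H1 : holds (iff (satz (switch_conj (S M) l) z r) (satz A z r)) w).
    { apply (IH (S M) i); auto; [now rewrite Nat.add_succ_r in Hon|].
      intros j Hj Hji. specialize (H (S j) ltac:(cbn; lia) ltac:(lia)).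
      now rewrite Nat.add_succ_r in H. }
    specialize (H 0 ltac:(cbn; lia) ltac:(lia)). rewrite Nat.add_0_r in H.
    split; imp_intro H2.
    + apply (holds_imp _ _ _ (proj1 H1)), H2.
    + split; [|apply (holds_imp _ _ _ (proj2 H1)), H2]. imp_intro H3.
      apply bot_elim, (holds_imp _ _ _ H), H3.
Qed.

(** Dually, a disjunct that is switched off is refuted and drops out. *)
Lemma switch_disj_spec l : forall M i A z r w, nth_error l i = Some A ->
  holds (inh (r (M + i))) w ->
  (forall j, j < length l -> j <> i -> holds (imp (inh (r (M + j))) bot) w) ->
  holds (iff (satz (switch_disj M l) z r) (satz A z r)) w.
Proof.
  assert (Hoff : forall l M z r w,
    (forall j, j < length l -> holds (imp (inh (r (M + j))) bot) w) ->
    holds (imp (satz (switch_disj M l) z r) bot) w).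
  { clear l. induction l as [|A l IH]; intros M z r w H; cbn [switch_disj satz].
    { imp_intro H1. exact H1. }
    assert (H0 : holds (imp (inh (r (M + 0))) bot) w) by (apply H; cbn; lia).
    rewrite Nat.add_0_r in H0.
    assert (H1 : holds (imp (satz (switch_disj (S M) l) z r) bot) w).
    { apply IH. intros j Hj. specialize (H (S j) ltac:(cbn; lia)).
      now rewrite Nat.add_succ_r in H. }
    clear H. imp_intro H2. disj_destruct H2 H2.
    - apply (holds_imp _ _ _ H0), H2.
    - apply (holds_imp _ _ _ H1), H2. }
  induction l as [|B l IH]; intros M i A z r w HA Hon H; [now destruct i|].
  destruct i as [|i]; cbn [nth_error switch_disj satz] in *.
  - injection HA as ->. rewrite Nat.add_0_r in Hon.
    assert (H1 : holds (imp (satz (switch_disj (S M) l) z r) bot) w).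
    { apply Hoff. intros j Hj. specialize (H (S j) ltac:(cbn; lia) ltac:(lia)).
      now rewrite Nat.add_succ_r in H. }
    clear H. split; imp_intro H.
    + disj_destruct H H; [apply H|]. apply bot_elim, (holds_imp _ _ _ H1), H.
    + apply disj_l. split; [exact Hon|exact H].
  - assert (H1 : holds (iff (satz (switch_disj (S M) l) z r) (satz A z r)) w).
    { apply (IH (S M) i); auto; [now rewrite Nat.add_succ_r in Hon|].
      intros j Hj Hji. specialize (H (S j) ltac:(cbn; lia) ltac:(lia)).
      now rewrite Nat.add_succ_r in H. }
    specialize (H 0 ltac:(cbn; lia) ltac:(lia)). rewrite Nat.add_0_r in H.
    split; imp_intro H2.
    + disj_destruct H2 H2.
      * apply bot_elim, (holds_imp _ _ _ H), H2.
      * apply (holds_imp _ _ _ (proj1 H1)), H2.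
    + apply disj_r, (holds_imp _ _ _ (proj2 H1)), H2.
Qed.

Definition instance (k : nat) (F : form) (c z : D) : Om :=
  decode k (satz F z) c (fun _ => d0).

Lemma Df_instance k F s t : Df true (fun v => instance k F (ev s v) (ev t v)).
Proof.
  apply (Df_subst _ _ (t .: s .: (fun _ => inr d0)) (Df_decode k (satz F)
    (Df_satz true F (fun i => inl (1 + i)) (inl 0)))).
Qed.

(* The last hypothesis is met by [switch_conj] and [switch_disj]. *)
Lemma instance_ex F M l A r : In A l -> (forall B, In B l -> fv_below M B) ->
  (forall i z r' w, nth_error l i = Some A -> holds (inh (r' (M + i))) w ->
    (forall j, j < length l -> j <> i -> holds (imp (inh (r' (M + j))) bot) w) ->
    holds (iff (satz F z r') (satz A z r')) w) ->
  forall w, holds (ex (fun c => all (fun z =>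
    iff (instance (M + length l) F c z) (satz A z r)))) w.
Proof.
  intros HA HM HF w. apply In_nth_error in HA as Hi. destruct Hi as [i Hi].
  assert (Hil : i < length l). { apply nth_error_Some. congruence. }
  ex_here (singleton_bound d0) s1 Hs1.
  match goal with |- holds _ ?w =>
    ex_destruct (separation d0 (fun _ => bot) w (Df_bot true)) s0 Hs0 end.
  (* The first [M] entries are the parameters; of the switches after them, the [i]-th is inhabited
     and the others are empty. *)
  set (a := fun j => if j <? M then r j else if j =? M + i then s1 else s0).
  ex_here (code_ex (M + length l) (satz F) a
    (Df_satz true F (fun i => inl (1 + i)) (inl 0)) (fun _ => d0)) c Hc.
  apply (holds_ex _ c). intros z. specialize (Hc z).
  set (r' := fun j => if j <? M + length l then a j else d0) in Hc.
  assert_here HFA (iff (satz F z r') (satz A z r')).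
  { apply (HF i); auto.
    - replace (r' (M + i)) with s1; [apply (holds_ex _ d0); split; [exact Hs1|apply eq_r]|].
      unfold r', a. destruct (Nat.ltb_spec (M + i) (M + length l)); [|lia].
      destruct (Nat.ltb_spec (M + i) M); [lia|]. now rewrite Nat.eqb_refl.
    - intros j Hj Hji. replace (r' (M + j)) with s0.
      + imp_intro H. ex_destruct H x Hx. destruct Hx as [Hx _].
        apply (holds_imp _ _ _ (proj1 (Hs0 x)) Hx).
      + unfold r', a. destruct (Nat.ltb_spec (M + j) (M + length l)); [|lia].
        destruct (Nat.ltb_spec (M + j) M); [lia|].
        destruct (Nat.eqb_spec (M + j) (M + i)); [lia|easy]. }
  replace (satz A z r') with (satz A z r) in HFA.
  2: { apply (satz_ext A M); [auto|]. intros j Hj. unfold r', a.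
    destruct (Nat.ltb_spec j (M + length l)); [|lia].
    destruct (Nat.ltb_spec j M); [easy|lia]. }
  split; imp_intro H.
  - apply (holds_imp _ _ _ (proj1 HFA)), (holds_imp _ _ _ (proj1 Hc)), H.
  - apply (holds_imp _ _ _ (proj2 Hc)), (holds_imp _ _ _ (proj2 HFA)), H.
Qed.

(** Splits off the Sigma-formulas or Pi-formulas of a list by excluded middle of the metatheory, in
    place of deciding these inductive classes. *)
Lemma classical_filter (P : form -> Prop) (L : list form) : exists l,
  (forall A, In A l -> P A /\ In A L) /\ (forall A, In A L -> P A -> In A l).
Proof.
  induction L as [|B L (l & H1 & H2)].
  { exists []. split; [intros A []|intros A []]. }
  destruct (classic (P B)) as [HB|HB].
  - exists (B :: l). split.
    + intros A [<-|HA]; [split; [exact HB|now left]|].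
      destruct (H1 A HA). split; [assumption|now right].
    + intros A [<-|HA] HP; [now left|right; auto].
  - exists l. split.
    + intros A HA. destruct (H1 A HA). split; [assumption|now right].
    + intros A [<-|HA] HP; [contradiction|auto].
Qed.

Lemma fv_below_common (L : list form) : exists M, forall A, In A L -> fv_below M A.
Proof.
  induction L as [|B L [M HM]]; [exists 0; contradiction|].
  destruct (fv_below_exists B) as [n Hn]. exists (n + M).
  intros A [<-|HA]; [apply (fv_below_mono _ n)|apply (fv_below_mono _ M)]; auto; lia.
Qed.

(** Supplies the forcing data: the elements of a condition code instances of the switched
    conjunction of all Pi-formulas in [L], and an answer codes an instance of the switched
    disjunction of all Sigma-formulas. *)
Lemma reflection_in_model L Ax A : In (BEx 0 (Eq 0 0)) L -> ND Ax [] (unfold A) ->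
  (forall B, Ax B -> exists C, IKP_SigmaRefl C /\ incl (subs C) L /\ B = unfold C) ->
  Sigma A -> incl (subs A) L -> forall r w, holds (ex (fun z => satz A z r)) w.
Proof.
  intros HL. destruct (fv_below_common L) as [M HM].
  destruct (classical_filter Pi L) as (lP & HP1 & HP2).
  destruct (classical_filter Sigma L) as (lS & HS1 & HS2).
  set (U := instance (M + length lP) (switch_conj M lP)).
  set (E := instance (M + length lS) (switch_disj M lS)).
  assert (HU : forall c, anti (U c)).
  { intros c z z' w Hz. apply decode_map. intros r. imp_intro H.
    revert H. apply (proj2 satz_mono); auto. apply switch_conj_Pi. firstorder. }
  apply (force_conservation (fun p z => ball p (fun c => U c z)) E); auto.
  - apply (Df_ball true (fun c v => U c (v 1)) (inl 0)).
    apply (Df_instance _ _ (inl 0) (inl 2)).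
  - apply (Df_instance _ _ (inl 0) (inl 1)).
  - intros p q z w H1 H2 c. imp_intro Hc. apply (holds_imp _ _ _ (H2 c)).
    eapply sub_mem; eauto.
  - intros p. apply (anti_ball p U). auto.
  - intros e z z' w Hz. apply decode_map. intros r. imp_intro H.
    revert H. apply (proj1 satz_mono); auto. apply switch_disj_Sigma. firstorder.
  (* The empty set is the condition without requirements. *)
  - intros w. ex_destruct (separation d0 (fun _ => bot) w (Df_bot true)) p Hp.
    apply (holds_ex _ p). intros z c. imp_intro Hc.
    apply bot_elim, (holds_imp _ _ _ (proj1 (Hp c)) Hc).
  - intros B HB HBP r p w.
    ex_destruct (instance_ex (switch_conj M lP) M lP B r (HP2 B HB HBP)
      (fun C HC => HM C (proj2 (HP1 C HC)))
      (fun i z r' w => switch_conj_spec lP M i B z r' w) w) c Hc.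
    (* The extension [q] consists of [p] and the one new code [c], separated from a common
       superset. *)
    ex_here (singleton_bound c) s Hs. ex_here (upper_bound2 p s) u Hu.
    assert (HD : Df true (fun v => disj (mem (v 0) p) (eq (v 0) c))).
    { apply Df_disj; [apply (Df_mem _ (inl 0) (inr p))|apply (Df_eq _ (inl 0) (inr c))]. }
    match goal with |- holds _ ?w =>
      ex_destruct (separation u (fun d => disj (mem d p) (eq d c)) w HD) q Hq end.
    destruct Hu as [Hu1 Hu2]. assert_here Hpq (sub p q).
    { intros d. imp_intro Hd. apply (holds_imp _ _ _ (proj2 (Hq d))).
      split; [apply (sub_mem p); auto|now apply disj_l]. }
    assert_here Hcq (mem c q).
    { apply (holds_imp _ _ _ (proj2 (Hq c))).
      split; [apply (sub_mem s); auto|apply disj_r, eq_r]. }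
    apply (holds_ex _ q). split; [exact Hpq|]. intros z. specialize (Hc z).
    split; imp_intro H.
    + split.
      * intros d. imp_intro Hd. apply (holds_imp _ _ _ (H d)), (sub_mem p); auto.
      * apply (holds_imp _ _ _ (proj1 Hc)), (holds_imp _ _ _ (H c) Hcq).
    + destruct H as [H1 H2]. apply (holds_imp _ _ _ (proj2 Hc)) in H2. intros d. imp_intro Hd.
      pose proof (holds_imp _ _ _ (proj1 (Hq d)) Hd) as [_ Hd'].
      disj_destruct Hd' Hd'; [apply (holds_imp _ _ _ (H1 d) Hd')|].
      (* An element [d] of [q] outside [p] is only equal to [c] in the sense of [eq]. *)
      apply (Df_resp true _ (fun _ => c) (fun _ => d) _
        (Df_instance (M + length lP) (switch_conj M lP) (inl 0) (inr z))); [|exact H2].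
      intros _. now apply eq_sym.
  - intros B HB HBS r w.
    apply (instance_ex (switch_disj M lS) M lS B r (HS2 B HB HBS)
      (fun C HC => HM C (proj2 (HS1 C HC)))
      (fun i z r' w => switch_disj_spec lS M i B z r' w) w).
Qed.

End Frame.

(** * Derivations and the canonical model *)

Lemma rename_subst0 A s x : rename s (subst0 A x) = subst0 (rename (up s) A) (s x).
Proof.
  unfold subst0. rewrite !rename_rename. f_equal. extensionality n. now destruct n.
Qed.

Lemma rename_up_inst A r x : subst0 (rename (up r) A) x = rename (x .: r) A.
Proof. unfold subst0. rewrite rename_rename. f_equal. extensionality n. now destruct n. Qed.

Lemma rename_lift A s : rename (up s) (lift A) = lift (rename s A).
Proof. unfold lift. now rewrite !rename_rename. Qed.

Lemma map_rename_lift G s : map (rename (up s)) (map lift G) = map lift (map (rename s) G).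
Proof. rewrite !map_map. apply map_ext. intros A. apply rename_lift. Qed.

Lemma ND_weaken Ax G A : ND Ax G A -> forall (Ax' : form -> Prop) G',
  (forall B, Ax B -> Ax' B) -> incl G G' -> ND Ax' G' A.
Proof.
  assert (Hc : forall (A : form) G G', incl G G' -> incl (A :: G) (A :: G')).
  { intros B G0 G' H C [<-|HC]; [now left|right; auto]. }
  induction 1; intros Ax' G' HAx Hi.
  - apply nd_hyp; auto.
  - apply nd_ax; auto.
  - apply nd_botE; auto.
  - apply nd_andI; auto.
  - apply nd_andE1 with B; auto.
  - apply nd_andE2 with A; auto.
  - apply nd_orI1; auto.
  - apply nd_orI2; auto.
  - apply nd_orE with A B; auto.
  - apply nd_impI; auto.
  - apply nd_impE with A; auto.
  - apply nd_allI, IHND; auto. now apply incl_map.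
  - apply nd_allE; auto.
  - apply nd_exI with x; auto.
  - apply nd_exE with A; auto. apply IHND2; auto. now apply Hc, incl_map.
  - apply nd_eqrefl.
  - apply nd_eqsubst with x; auto.
Qed.

Lemma ND_rename Ax G A : (forall B s, Ax B -> Ax (rename s B)) -> ND Ax G A ->
  forall s, ND Ax (map (rename s) G) (rename s A).
Proof.
  intros HAx. induction 1; intros s; cbn [rename map] in *.
  - apply nd_hyp. now apply in_map.
  - apply nd_ax. auto.
  - apply nd_botE, IHND.
  - apply nd_andI; auto.
  - eapply nd_andE1, IHND.
  - eapply nd_andE2, IHND.
  - apply nd_orI1; auto.
  - apply nd_orI2; auto.
  - eapply nd_orE; [apply IHND1|apply IHND2|apply IHND3].
  - apply nd_impI; auto.
  - eapply nd_impE; [apply IHND1|apply IHND2].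
  - apply nd_allI. specialize (IHND (up s)). now rewrite map_rename_lift in IHND.
  - rewrite rename_subst0. apply nd_allE, IHND.
  - apply nd_exI with (s x). rewrite <- rename_subst0. apply IHND.
  - eapply nd_exE; [apply IHND1|]. specialize (IHND2 (up s)).
    now rewrite map_rename_lift, rename_lift in IHND2.
  - apply nd_eqrefl.
  - rewrite rename_subst0 in *. apply nd_eqsubst with (s x); [apply IHND1|].
    rewrite <- rename_subst0. apply IHND2.
Qed.

(** Lets the forcing be set up for the finitely many axioms of one derivation. *)
Lemma ND_finite Ax G A : ND Ax G A ->
  exists l, (forall B, In B l -> Ax B) /\ ND (fun B => In B l) G A.
Proof.
  assert (HL : forall G A l l', ND (fun B => In B l) G A -> ND (fun B => In B (l ++ l')) G A).
  { intros G0 A0 l l' H. apply (ND_weaken _ _ _ H); [|apply incl_refl].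
    intros B HB. apply in_or_app; auto. }
  assert (HR : forall G A l l', ND (fun B => In B l') G A -> ND (fun B => In B (l ++ l')) G A).
  { intros G0 A0 l l' H. apply (ND_weaken _ _ _ H); [|apply incl_refl].
    intros B HB. apply in_or_app; auto. }
  assert (HA : forall l l' : list form, (forall B, In B l -> Ax B) ->
    (forall B, In B l' -> Ax B) -> forall B, In B (l ++ l') -> Ax B).
  { intros l l' H1 H2 B HB. apply in_app_or in HB as [HB|HB]; auto. }
  induction 1 as [G A HI|G A HI|G A _ (l & Hl & H)|G A B _ (l & Hl & H) _ (l' & Hl' & H')
    |G A B _ (l & Hl & H)|G A B _ (l & Hl & H)|G A B _ (l & Hl & H)|G A B _ (l & Hl & H)
    |G A B C _ (l & Hl & H) _ (l' & Hl' & H') _ (l'' & Hl'' & H'')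
    |G A B _ (l & Hl & H)|G A B _ (l & Hl & H) _ (l' & Hl' & H')|G A _ (l & Hl & H)
    |G A x _ (l & Hl & H)|G A x _ (l & Hl & H)|G A B _ (l & Hl & H) _ (l' & Hl' & H')
    |G x|G A x y _ (l & Hl & H) _ (l' & Hl' & H')].
  - exists []. split; [intros B []|now apply nd_hyp].
  - exists [A]. split; [intros B [<-|[]]; auto|apply nd_ax; now left].
  - exists l. split; [exact Hl|now apply nd_botE].
  - exists (l ++ l'). split; [exact (HA _ _ Hl Hl')|apply nd_andI; auto].
  - exists l. split; [exact Hl|now apply nd_andE1 with B].
  - exists l. split; [exact Hl|now apply nd_andE2 with A].
  - exists l. split; [exact Hl|now apply nd_orI1].
  - exists l. split; [exact Hl|now apply nd_orI2].
  - exists (l ++ l' ++ l''). split; [exact (HA _ _ Hl (HA _ _ Hl' Hl''))|].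
    apply nd_orE with A B; auto.
  - exists l. split; [exact Hl|now apply nd_impI].
  - exists (l ++ l'). split; [exact (HA _ _ Hl Hl')|apply nd_impE with A; auto].
  - exists l. split; [exact Hl|now apply nd_allI].
  - exists l. split; [exact Hl|now apply nd_allE].
  - exists l. split; [exact Hl|now apply nd_exI with x].
  - exists (l ++ l'). split; [exact (HA _ _ Hl Hl')|apply nd_exE with A; auto].
  - exists []. split; [intros B []|apply nd_eqrefl].
  - exists (l ++ l'). split; [exact (HA _ _ Hl Hl')|apply nd_eqsubst with x; auto].
Qed.

Lemma IKP_rename A s : IKP A -> IKP (rename s A).
Proof.
  intros H. destruct H as [| | | |A HA|A HA|A]; unfold Iff; cbn [rename].
  1-4: now constructor.
  - replace (rename (up (up (up s))) (rename (shift_from 1 2) A))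
      with (rename (shift_from 1 2) (rename (up s) A)).
    + apply (ikp_sep (rename (up s) A)). now apply Delta0_rename.
    + rewrite !rename_rename. f_equal. extensionality n. unfold shift_from.
      destruct n; cbn; [easy|]. now rewrite !(Nat.add_comm _ 2).
  - replace (rename (up (up (up s))) (rename (shift_from 2 1) A))
      with (rename (shift_from 2 1) (rename (up (up s)) A)).
    replace (rename (up (up (up (up s)))) (rename (shift_from 2 2) A))
      with (rename (shift_from 2 2) (rename (up (up s)) A)).
    + apply (ikp_coll (rename (up (up s)) A)). now apply Delta0_rename.
    + rewrite !rename_rename. f_equal. extensionality n. unfold shift_from.
      destruct n as [|[|n]]; cbn; try easy. now rewrite !(Nat.add_comm _ 2).
    + rewrite !rename_rename. f_equal. extensionality n. unfold shift_from.
      destruct n as [|[|n]]; cbn; try easy. now rewrite !(Nat.add_comm _ 1).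
  - replace (rename (up (up s)) (rename (shift_from 1 1) A))
      with (rename (shift_from 1 1) (rename (up s) A)).
    + apply (ikp_ind (rename (up s) A)).
    + rewrite !rename_rename. f_equal. extensionality n. unfold shift_from.
      destruct n; cbn; [easy|]. now rewrite !(Nat.add_comm _ 1).
Qed.

(** Choose [x] beyond the variables of [G] and those that [r] substitutes into [A]; the renaming [s]
    sends [x] to 0 and shifts the rest. It turns a derivation for the individual [x] into the
    eigenvariable premise of a quantifier rule. *)
Lemma fresh_variable G A r : exists x s,
  map (rename s) G = map lift G /\ rename s (rename (x .: r) A) = rename (up r) A.
Proof.
  destruct (fv_below_common G) as [M HM]. destruct (fv_below_exists A) as [n Hn].
  assert (Hr : exists K, forall i, i < n -> r i < K).
  { clear. induction n as [|n [K HK]]; [exists 0; lia|]. exists (S (r n + K)). intros i Hi.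
    destruct (Nat.eq_dec i n) as [->|]; [lia|]. specialize (HK i). lia. }
  destruct Hr as [K HK]. exists (M + K), (fun y => if y =? M + K then 0 else S y). split.
  - apply map_ext_in. intros B HB. apply (rename_ext B M); auto. intros i Hi.
    destruct (Nat.eqb_spec i (M + K)); [lia|easy].
  - rewrite rename_rename. apply (rename_ext A n); auto. intros [|i] Hi; cbn.
    + now rewrite Nat.eqb_refl.
    + specialize (HK i). destruct (Nat.eqb_spec (r i) (M + K)); [lia|easy].
Qed.

(** * The canonical model, and conservation *)

Section Canonical.

Let IKP_unfolded (B : form) : Prop := exists C, IKP C /\ B = unfold C.
Let le_ctx (G G' : list form) : Prop := incl G G'.
Let derivable (B : form) (G : list form) : Prop := ND IKP_unfolded G B.

Lemma derivable_mono B G G' : le_ctx G G' -> derivable B G -> derivable B G'.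
Proof. intros H1 H2. exact (ND_weaken _ _ _ H2 _ _ (fun _ H => H) H1). Qed.

Lemma le_ctx_trans G1 G2 G3 : le_ctx G1 G2 -> le_ctx G2 G3 -> le_ctx G1 G3.
Proof. apply incl_tran. Qed.

Lemma derivable_rename B G s : derivable B G -> derivable (rename s B) (map (rename s) G).
Proof.
  intros H. refine (ND_rename _ _ _ _ H s). intros C t (C' & H1 & ->).
  exists (rename t C'). split; [now apply IKP_rename|]. now rewrite unfold_rename.
Qed.

(* Variables are the individuals and contexts are the worlds. *)
Let truth := @sat _ _ nat le_ctx derivable (@incl_refl form) le_ctx_trans
  (fun i j => base (@incl_refl form) derivable_mono (Mem i j))
  (fun i j => base (@incl_refl form) derivable_mono (Eq i j)).

Let good (A : form) : Prop := forall r G,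
  holds (truth A r) G <-> derivable (rename r A) G.

Lemma good_And A B : good A -> good B -> good (And A B).
Proof.
  intros HA HB r G. cbn. rewrite (HA r G), (HB r G). split.
  - intros [H1 H2]. now apply nd_andI.
  - intros H. split; [eapply nd_andE1|eapply nd_andE2]; exact H.
Qed.

(** The closure in [disj] quantifies over all conclusions, just as disjunction elimination does;
    conversely the disjunction itself is taken as conclusion. *)
Lemma good_Or A B : good A -> good B -> good (Or A B).
Proof.
  intros HA HB r G. split.
  - intros H. apply H; [apply incl_refl|]. intros G' l [|] Hb;
      [apply nd_orI1; now apply HA|apply nd_orI2; now apply HB].
  - intros H C G1 l H1. apply nd_orE with (rename r A) (rename r B).
    + exact (derivable_mono _ _ _ l H).
    + apply (H1 _ (incl_tl _ (incl_refl G1)) true). apply HA. apply nd_hyp. now left.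
    + apply (H1 _ (incl_tl _ (incl_refl G1)) false). apply HB. apply nd_hyp. now left.
Qed.

Lemma good_Imp A B : good A -> good B -> good (Imp A B).
Proof.
  intros HA HB r G. split.
  - intros H. apply nd_impI. apply HB. apply H; [now apply incl_tl, incl_refl|].
    apply HA. apply nd_hyp. now left.
  - intros H G' l H1. apply HB. apply nd_impE with (rename r A).
    + exact (derivable_mono _ _ _ l H).
    + now apply HA.
Qed.

Lemma good_All A : good A -> good (All A).
Proof.
  intros HA r G. split.
  - intros H. destruct (fresh_variable G A r) as (x & s & H1 & H2).
    cbn [rename]. apply nd_allI. rewrite <- H1, <- H2. apply derivable_rename, HA, (H x).
  - intros H x. apply HA. rewrite <- rename_up_inst. now apply nd_allE.
Qed.

Lemma good_Ex A : good A -> good (Ex A).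
Proof.
  intros HA r G. split.
  - intros H. apply H; [apply incl_refl|]. intros G' l x Hx.
    apply nd_exI with x. rewrite rename_up_inst. now apply HA.
  - intros H C G1 l H1. apply nd_exE with (rename (up r) A).
    + exact (derivable_mono _ _ _ l H).
    + destruct (fresh_variable (C :: G1) A r) as (x & s & H2 & H3).
      injection H2 as H2 H4. rewrite <- H2, <- H3, <- H4.
      apply (derivable_rename C (rename (x .: r) A :: G1)).
      apply (H1 _ (incl_tl _ (incl_refl G1)) x). apply HA. apply nd_hyp. now left.
Qed.

(** Restricted to unfolded formulas because the calculus has rules for unbounded quantifiers
    only. *)
Lemma truth_derivable A : good (unfold A).
Proof.
  induction A; cbn [unfold].
  - easy.
  - easy.
  - intros r G. split.
    + intros H. apply (H Bot G). apply incl_refl.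
    + intros H C G' l. apply nd_botE. exact (derivable_mono _ _ _ l H).
  - now apply good_And.
  - now apply good_Or.
  - now apply good_Imp.
  - now apply good_All.
  - now apply good_Ex.
  - now apply good_All, good_Imp.
  - now apply good_Ex, good_And.
Qed.

Lemma truth_Prov A : holds (truth A (fun n => n)) [] -> Prov IKP A.
Proof.
  unfold truth. rewrite <- sat_unfold. intros H. apply truth_derivable in H.
  now rewrite rename_id in H.
Qed.

Lemma truth_IKP C : IKP C -> forall r G, holds (truth C r) G.
Proof.
  intros HC r G. unfold truth. rewrite <- sat_unfold. apply truth_derivable.
  rewrite <- unfold_rename. apply nd_ax. exists (rename r C).
  split; [now apply IKP_rename|easy].
Qed.

Lemma truth_eq A r x y G : derivable (Eq x y) G ->
  holds (truth A (x .: r)) G -> holds (truth A (y .: r)) G.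
Proof.
  unfold truth. rewrite <- (sat_unfold _ _ _ _ A (x .: r)), <- (sat_unfold _ _ _ _ A (y .: r)).
  intros H1 H2. apply truth_derivable in H2. apply truth_derivable.
  rewrite <- rename_up_inst in *. now apply nd_eqsubst with x.
Qed.

Lemma SigmaRefl_conservation A : Sigma A -> Prov IKP_SigmaRefl A ->
  Prov IKP A /\ Prov IKP (Ex (rel (lift A) 0)).
Proof.
  intros HA HP. destruct (ND_finite _ _ _ HP) as (l & Hl & HD).
  assert (HC : exists lC, forall B, In B l -> exists C, In C lC /\ IKP_SigmaRefl C /\ B = unfold C).
  { clear - Hl. induction l as [|B l IH]; [exists []; intros B []|].
    destruct IH as [lC HlC]; [auto with datatypes|].
    destruct (Hl B (or_introl eq_refl)) as (C & HC1 & HC2).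
    exists (C :: lC). intros B' [<-|HB']; [exists C; cbn; auto|].
    destruct (HlC B' HB') as (C' & H1 & H2). exists C'. cbn; auto. }
  destruct HC as [lC HlC].
  (* Everything the forcing must code: inhabitedness, and all subformulas of [A] and of the axioms
     in the derivation. *)
  pose (L := BEx 0 (Eq 0 0) :: flat_map subs (A :: lC)).
  assert (HL : forall C, In C (A :: lC) -> incl (subs C) L).
  { intros C HC B HB. right. apply in_flat_map. eauto. }
  assert (HAx : forall B, In B l ->
    exists C, IKP_SigmaRefl C /\ incl (subs C) L /\ B = unfold C).
  { intros B HB. destruct (HlC B HB) as (C & H2 & H3 & H4). exists C.
    repeat split; auto. apply HL. now right. }
  pose proof (reflection_in_model (@incl_refl form) le_ctx_trans
    (fun i j => base (@incl_refl form) derivable_mono (Mem i j))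
    (fun i j => base (@incl_refl form) derivable_mono (Eq i j))
    0 truth_IKP (fun x G => nd_eqrefl _ G x) truth_eq L _ A (or_introl eq_refl) HD HAx
    HA (HL A (or_introl eq_refl)) (fun n => n) []) as H.
  (* Both conclusions follow from the bound [z] found in the model at the empty context: the first
     by upward persistence, the second by reading [satz] as satisfaction of the relativised
     formula. *)
  split; apply truth_Prov.
  - refine (ex_elim _ _ _ _ _ H _). intros w' l' z Hz. revert Hz.
    now apply satz_sat.
  - refine (ex_elim _ _ _ _ _ H _). intros w' l' z Hz.
    unfold truth. cbn [sat]. apply (holds_ex _ _ _ z). unfold lift. rewrite sat_rel. exact Hz.
Qed.

End Canonical.

Theorem theorem2p37 :
  (forall A : form, sentence A -> Sigma A ->
     (Prov IKP_SigmaRefl A <-> Prov IKP A)) /\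
  (forall A : form, sentence A -> Sigma A -> Prov IKP A ->
     Prov IKP (Ex (rel (lift A) 0))).
Proof.
  assert (Hsub : forall A, Prov IKP A -> Prov IKP_SigmaRefl A).
  { intros A H. apply (ND_weaken _ _ _ H); [|apply incl_refl].
    intros B (C & HC & ->). exists C. split; [now left|easy]. }
  split.
  - intros A _ HA. split; [intros H; now apply SigmaRefl_conservation|apply Hsub].
  - intros A _ HA H. apply SigmaRefl_conservation; auto.
Qed.
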